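(* Let $N$ be a spherical bipartite network with equatorial vertices $1,\dots,n$, all colored black, and let $k$ be the number of white vertices in $N\setminus H$ minus the number of black vertices in $N\setminus H$. Suppose $\Delta_I(N)\ne0$ for some $k$-element subset $I\subset[n]$. Then the vector $X(N)=(\Delta_I(N)\mid I\subset[n],\,|I|=k)$ defines a point in the Grassmannian $\mathrm{Gr}(k,n)$ (i.e. it is the vector of Plücker coordinates of such a point).
   Context: Let $S^2$ be the two-sphere, $H\subset S^2$ the equator, $H^+$ and $H^-$ the closed upper and lower hemispheres, so $H^+\cap H^-=H$. A spherical bipartite network is a weighted bipartite (black/white) graph $N$ embedded in $S^2$ with distinguished vertices $1,2,\dots,n$ arranged in order on $H$, such that $N\cap H$ consists only of these distinguished vertices, and both $N\cap H^+$ and $N\cap H^-$ are planar bipartite networks in the closed disks $H^\pm$ with boundary vertices $1,\dots,n$ (each boundary vertex having degree $1$ in each of the two networks and being joined to interior vertices of the disk). All vertices on $H$ are assumed black. An almost perfect matching $\Pi$ of $N$ is a collection of edges using every vertex of $N\setminus H$ exactly once and each of the vertices $1,\dots,n$ at most once. $I(\Pi)\subset[n]$ is the set of equatorial vertices used; $I^+(\Pi)$ (resp. $I^-(\Pi)$) is the set of equatorial vertices matched by an edge in $H^+$ (resp. $H^-$), so $I(\Pi)=I^+(\Pi)\sqcup I^-(\Pi)$. One has $|I(\Pi)|=k$. The equatorial measurement is $$\Delta_I(N)=\sum_{\Pi:\,I(\Pi)=I}(-1)^{\mathrm{inv}(I^+(\Pi),I^-(\Pi))}\,\mathrm{wt}(\Pi),$$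 where $\mathrm{inv}(A,B)=\#\{(a,b)\in A\times B: a>b\}$ and $\mathrm{wt}(\Pi)$ is the product of the weights of edges in $\Pi$. $\mathrm{Gr}(k,n)$ is the Grassmannian of $k$-planes in $\mathbb{C}^n$ with its Plücker embedding. *)

(* Defs.v *)
From HB Require Import structures.
From mathcomp Require Import all_boot all_order all_algebra.
From mathcomp Require Import complex.
From mathcomp Require Import all_classical all_reals all_analysis.

Set Implicit Arguments.
Unset Strict Implicit.
Unset Printing Implicit Defensive.

Import Order.TTheory GRing.Theory Num.Theory.
Import numFieldNormedType.Exports.

Local Open Scope classical_set_scope.
Local Open Scope ring_scope.

Section Sphere.
Variable R : realType.

Definition sphere : set 'rV[R]_3 :=
  [set p | p 0 0 ^+ 2 + p 0 1 ^+ 2 + p 0 2 ^+ 2 = 1].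
Definition equator : set 'rV[R]_3 := sphere `&` [set p | p 0 2 = 0].
Definition upper_hemisphere : set 'rV[R]_3 := sphere `&` [set p | 0 <= p 0 2].
Definition lower_hemisphere : set 'rV[R]_3 := sphere `&` [set p | p 0 2 <= 0].

Definition equator_point (theta : R) : 'rV[R]_3 :=
  \row_(j < 3) [:: cos theta; sin theta; 0]`_j.

(* The points p 0, ..., p n.-1 are met in this order during one turn around
   the equator, starting at p 0; both directions of travel are allowed. *)
Definition in_order_on_equator (n : nat) (p : 'I_n -> 'rV[R]_3) : Prop :=
  exists theta : 'I_n -> R,
    [/\ forall i, p i = equator_point (theta i),
        forall i j, `|theta i - theta j| < 2 * pi
      & (forall i j : 'I_n, (i < j)%N -> theta i < theta j) \/
        (forall i j : 'I_n, (i < j)%N -> theta j < theta i)].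

End Sphere.

(* A finite bipartite graph (parallel edges are allowed) with complex edge
   weights, drawn on the sphere. The edge e is drawn as the simple arc
   curve e : [0, 1] -> sphere, running from its black to its white end; the
   values of curve e outside [0, 1] are irrelevant. *)
Record spherical_network (R : realType) (n : nat) := SphericalNetwork {
  vertex : finType;
  edge : finType;
  black : pred vertex;
  bend : edge -> vertex;
  wend : edge -> vertex;
  weight : edge -> R[i];
  bend_black : forall e, black (bend e);
  wend_white : forall e, ~~ black (wend e);

  pos : vertex -> 'rV[R]_3;
  curve : edge -> R -> 'rV[R]_3;
  pos_sphere : forall v, sphere (pos v);
  pos_inj : injective pos;
  curve_sphere : forall e, curve e @` `[0, 1] `<=` @sphere R;
  curve_continuous : forall e, {within `[0, 1], continuous (curve e)};
  curve_inj : forall e, {in `[0, 1] &, injective (curve e)};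
  curve0 : forall e, curve e 0 = pos (bend e);
  curve1 : forall e, curve e 1 = pos (wend e);
  curve_vertex : forall e v t, t \in `]0, 1[ -> curve e t <> pos v;
  curve_disjoint : forall e e' s t, e != e' ->
    s \in `]0, 1[ -> t \in `]0, 1[ -> curve e s <> curve e' t;

  bdry : 'I_n -> vertex;
  bdry_in_order : in_order_on_equator (fun i => pos (bdry i));
  (* N `&` H consists only of the distinguished vertices *)
  network_equator :
    (range pos `|` \bigcup_e (curve e @` `[0, 1])) `&` @equator R
    = range (fun i => pos (bdry i));

  (* the intersections of N with the closed hemispheres are networks, in which
     every distinguished vertex has degree 1 and an interior neighbour *)
  edge_hemisphere : forall e,
    curve e @` `[0, 1] `<=` @upper_hemisphere R \/
    curve e @` `[0, 1] `<=` @lower_hemisphere R;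
  bdry_upper_degree : forall i,
    #|[set e | ((bend e == bdry i) || (wend e == bdry i)) &&
               `[< curve e @` `[0, 1] `<=` @upper_hemisphere R >] ]%SET| = 1%N;
  bdry_lower_degree : forall i,
    #|[set e | ((bend e == bdry i) || (wend e == bdry i)) &&
               `[< curve e @` `[0, 1] `<=` @lower_hemisphere R >] ]%SET| = 1%N;
  bdry_neighbour : forall e,
    ~~ ((bend e \in codom bdry) && (wend e \in codom bdry))
}.

Section Measurement.
Variables (R : realType) (n : nat) (N : spherical_network R n).

Definition incident (e : edge N) (v : vertex N) : bool :=
  (bend e == v) || (wend e == v).
Definition upper_edge (e : edge N) : bool :=
  `[< curve e @` `[0, 1] `<=` @upper_hemisphere R >].
Definition lower_edge (e : edge N) : bool :=
  `[< curve e @` `[0, 1] `<=` @lower_hemisphere R >].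

Definition interior_black : {set vertex N} :=
  [set v | black v && (v \notin codom (@bdry R n N))]%SET.
Definition interior_white : {set vertex N} :=
  [set v | ~~ black v && (v \notin codom (@bdry R n N))]%SET.

Definition almost_perfect (P : {set edge N}) : bool :=
  [forall v : vertex N, (v \notin codom (@bdry R n N)) ==>
     (#|[set e in P | incident e v]%SET| == 1%N)] &&
  [forall i : 'I_n, #|[set e in P | incident e (bdry N i)]%SET| <= 1]%N.

Definition used (P : {set edge N}) : {set 'I_n} :=
  [set i | [exists e in P, incident e (bdry N i)]]%SET.
Definition used_upper (P : {set edge N}) : {set 'I_n} :=
  [set i | [exists e in P, incident e (bdry N i) && upper_edge e]]%SET.
Definition used_lower (P : {set edge N}) : {set 'I_n} :=
  [set i | [exists e in P, incident e (bdry N i) && lower_edge e]]%SET.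

Definition inversions (A B : {set 'I_n}) : nat :=
  #|[set ab : 'I_n * 'I_n |
      [&& ab.1 \in A, ab.2 \in B & (ab.2 < ab.1)%N]]%SET|.

Definition equatorial_measurement (I : {set 'I_n}) : R[i] :=
  \sum_(P : {set edge N} | almost_perfect P && (used P == I))
    (-1) ^+ inversions (used_upper P) (used_lower P) * \prod_(e in P) weight e.

End Measurement.

Section Grassmannian.
Variables (F : fieldType) (n : nat).

(* The maximal minor, in the columns I taken in increasing order, of the matrix
   whose rows are the vectors of a basis of V (meaningful when \dim V = k). *)
Definition plucker_coord (V : {vspace 'rV[F]_n}) (k : nat) (I : {set 'I_n})
    (cardI : #|I| = k) : F :=
  \det (\matrix_(i < k, j < k)
          (vbasis V)`_i 0 (enum_val (cast_ord (esym cardI) j))).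

(* Plucker coordinates are homogeneous, hence the nonzero factor c; it cannot
   be absorbed in the choice of a basis when k = 0. *)
Definition Grassmannian_point (k : nat) (X : {set 'I_n} -> F) : Prop :=
  exists2 V : {vspace 'rV[F]_n}, \dim V = k &
  exists2 c : F, c != 0 &
  forall (I : {set 'I_n}) (cardI : #|I| = k), X I = c * plucker_coord V cardI.

End Grassmannian.

(* Main.v *)
Require Import Defs.
From HB Require Import structures.
From mathcomp Require Import all_boot all_order all_algebra.
From mathcomp Require Import fingroup perm.
From mathcomp Require Import zify ring lra.
From mathcomp Require Import complex.
From mathcomp Require Import all_classical all_reals all_analysis.

(** Cut every equatorial vertex into an upper and a lower slot. An almost perfect
matching is then a matching of the interior vertices together with the set of
slots that it uses, and the sign of its term in the measurement depends only on
that set. Let X S be the unsigned sum of the weights of the matchings with slot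
set S ([matching_sum]). The theorem follows from two facts.

The function X satisfies the quadratic Pluecker relations for the linear order
in which the upper slots precede the lower ones ([matching_sum_plucker]). A
relation is a signed sum over a slot a and two matchings P and Q. Superimpose
them: the component of the symmetric difference that contains a is a path, and
it ends at another slot b, where the edge belongs to the other matching because
all slots are black ([path_ends]). Exchanging P and Q along this path gives the
term of b. It has the same weight, and it has the opposite sign because the
slots strictly between a and b that are used by exactly one of P and Q are
joined to each other by paths of the same kind: a path that leaves the interval
would cross the path from a to b, which planarity forbids ([no_crossing]). So
the terms cancel in pairs.

A function with these relations and a nonzero value is, up to a scalar, the
vector of maximal minors of a matrix whose columns are indexed by the slots
([plucker_minors]). Add the two columns at the slots of each equatorial vertex.
Expanding the minors of the sum column by column gives the signed sum of the
values X S over the sets S that use one slot at each vertex of I; sorting the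
columns so that upper slots come first produces the sign with exponent
inv(I+, I-). So the measurement consists of minors of the matrix with the added
columns, and its row space is the required point
([fold_slots_Grassmannian], [equatorial_measurement_fold_slots]).

Planarity is used only in this form: in a closed hemisphere, disjoint unions of
arcs cannot join interleaved pairs of equatorial points. Stereographic
projection from an equatorial point turns the hemisphere into a half-plane. If
x travels from a to b and y from c to d in the closed upper half-plane, with
a < c < b < d on the axis, then x - y makes a full turn around the origin while
the pair of parameters runs around the boundary of their rectangle; this is
impossible if x - y never vanishes. [discrete_crossing] is this statement for
finite sequences with small steps, which can be extracted from arcs without
concatenating them. *)

Set Implicit Arguments.
Unset Strict Implicit.
Unset Printing Implicit Defensive.

Import Order.TTheory GRing.Theory Num.Theory.
Import numFieldNormedType.Exports.

Local Open Scope ring_scope.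

(** * Pluecker relations and minors *)

Section Signs.
Variables (T : finType) (r : T -> nat).
Hypothesis r_inj : injective r.
Variable F : fieldType.

Definition order_sign (x y : T) : F :=
  if x == y then 0 else (-1) ^+ (r y < r x)%N.

(** The sign of the number of inversions of t, and 0 if an entry repeats. It turns
a function of sets into an alternating function of sequences. *)
Definition inversion_sign k (t : 'I_k -> T) : F :=
  \prod_(i < k) \prod_(j < k | (i < j)%N) order_sign (t i) (t j).

Lemma order_signE x y : order_sign x y = (Num.sg ((r y)%:Z - (r x)%:Z))%:~R.
Proof.
rewrite /order_sign; case: eqVneq => [->|xy]; first by rewrite subrr sgr0.
have : r x != r y by rewrite (inj_eq r_inj).
rewrite neq_ltn; case: ltngtP => // xy' _.
- by rewrite gtr0_sg ?expr0 // subr_gt0 ltz_nat.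
- by rewrite ltr0_sg ?expr1 // subr_lt0 ltz_nat.
Qed.

Lemma sgr_prod (I : Type) (s : seq I) (P : pred I) (G : I -> int) :
  Num.sg (\prod_(i <- s | P i) G i) = \prod_(i <- s | P i) Num.sg (G i).
Proof. by apply: (big_morph _ (@sgrM int)); rewrite sgr1. Qed.

(** The sign is that of a Vandermonde determinant, so that permuting the entries
is permuting columns. *)
Lemma inversion_sign_Vandermonde k (t : 'I_k -> T) :
  inversion_sign t =
  (Num.sg (\det (Vandermonde k (\row_j ((r (t j))%:Z : int)))))%:~R.
Proof.
rewrite det_Vandermonde sgr_prod rmorph_prod; apply: eq_bigr => i _.
rewrite sgr_prod rmorph_prod; apply: eq_bigr => j _.
by rewrite order_signE !mxE.
Qed.

Lemma inversion_sign_perm k (t : 'I_k -> T) (s : 'S_k) :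
  inversion_sign (fun i => t (s i)) = (-1) ^+ s * inversion_sign t.
Proof.
rewrite !inversion_sign_Vandermonde.
have -> : Vandermonde k (\row_j ((r (t (s j)))%:Z : int)) =
  col_perm s (Vandermonde k (\row_j ((r (t j))%:Z : int))).
  by apply/matrixP => i j; rewrite !mxE.
rewrite col_permE det_mulmx det_perm odd_permV mulrC sgrM rmorphM /=; congr (_ * _).
by case: (odd_perm s); rewrite ?expr0 ?expr1 ?sgr1 ?sgrN1.
Qed.

Lemma inversion_sign_eq0 k (t : 'I_k -> T) i j : i != j -> t i = t j -> inversion_sign t = 0.
Proof.
wlog ij : i j / (i < j)%N.
  move=> H nij tij; case: (ltngtP i j) => [lij|lij|eij].
  - exact: (H i j).
  - by apply: (H j i); rewrite // eq_sym.
  - by move: nij; rewrite -val_eqE /= eij eqxx.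
move=> _ tij; rewrite /inversion_sign (bigD1 i) //= (bigD1 j) //=.
by rewrite /order_sign tij eqxx !mul0r.
Qed.

Definition replace_entry k (t : {ffun 'I_k -> T}) j b : {ffun 'I_k -> T} :=
  [ffun l => if l == j then b else t l].

Definition below (K : {set T}) a := #|[set x in K | (r x < r a)%N]|.

(** Isolates the dependence on the entry at position j. The pairs with l > j come
in the wrong orientation; turning them costs a sign that does not depend on the
entry. *)
Lemma inversion_sign_split k (t : 'I_k -> T) j :
  inversion_sign t =
  (\prod_(p : 'I_k * 'I_k | [&& (p.1 < p.2)%N, p.1 != j & p.2 != j])
     order_sign (t p.1) (t p.2)) *
  \prod_(l | l != j) ((-1) ^+ (j < l)%N * order_sign (t l) (t j)).
Proof.
rewrite /inversion_sign pair_big_dep /= (bigID (fun p => (p.1 != j) && (p.2 != j))) /=.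
congr (_ * _).
rewrite (bigID (fun p => p.1 == j)) /= mulrC.
rewrite [RHS](bigID (fun l : 'I_k => (l < j)%N)) /=; congr (_ * _).
- rewrite (reindex_onto (fun l => (l, j)) (fun p => p.1)) /=.
    apply: eq_big => [l|l]; last first.
      move=> /andP[/andP[/andP[lj _] _] _].
      have -> : (j < l)%N = false by lia.
      by rewrite expr0 mul1r.
    rewrite !eqxx andbT /= andbF /= !andbT.
    case: (eqVneq l j) => [->|]; first by rewrite ltnn.
    by rewrite andbT.
  case=> p q /= /andP[/andP[pq]]; rewrite negb_and !negbK => /orP[/eqP->|/eqP->//].
  by rewrite eqxx.
- rewrite (reindex_onto (fun l => (j, l)) (fun p => p.2)) /=.
    apply: eq_big => [l|l].
      rewrite !eqxx /= !andbT.
      case: (ltngtP l j) => [lj|lj|lj]; first by rewrite ?andbF.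
        by rewrite andbT -(inj_eq val_inj) /= gtn_eqF.
      by rewrite (val_inj lj) eqxx.
    rewrite !eqxx /= !andbT => jl; rewrite jl expr1.
    rewrite /order_sign eq_sym; case: eqVneq => [|tlj]; first by rewrite mulr0.
    have : r (t j) != r (t l) by rewrite (inj_eq r_inj) eq_sym.
    by rewrite neq_ltn; case: ltngtP => //= _ _; rewrite ?expr0 ?expr1 ?mulrNN ?mulr1.
  by case=> p q /= /andP[_ /eqP->].
Qed.

Lemma prod_order_sign (L : {set T}) a : a \notin L ->
  \prod_(x in L) order_sign x a = (-1) ^+ (#|L| + below L a).
Proof.
move=> aL.
transitivity (\prod_(x in L) (-1 * (-1) ^+ (r x < r a)%N) : F).
  apply: eq_bigr => x xL; rewrite /order_sign.
  case: eqVneq => [xa|xa]; first by rewrite -xa xL in aL.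
  have : r x != r a by rewrite (inj_eq r_inj).
  by rewrite neq_ltn; case: ltngtP => //= _ _; rewrite ?expr0 ?expr1 ?mulrNN ?mulr1.
rewrite big_split /= prodr_const exprD; congr (_ * _).
rewrite (bigID (fun x => (r x < r a)%N)) /= [X in _ * X]big1 ?mulr1; last first.
  by move=> x /andP[_ /negPf->].
rewrite (eq_bigr (fun _ => -1)); last by move=> x /andP[_ ->].
by rewrite prodr_const /below; congr (_ ^+ _); apply: eq_card => x; rewrite !inE.
Qed.

(** When the value t j is moved to b, it passes each of the remaining entries that
lie between the two values once. *)
Lemma inversion_sign_replace k (t : {ffun 'I_k -> T}) j b (L := (t @: [set: 'I_k]) :\ t j) :
  injective t -> b \notin L ->
  inversion_sign (replace_entry t j b) = inversion_sign t * (-1) ^+ (below L (t j) + below L b).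
Proof.
move=> ti bL.
have E c : c \notin L ->
    \prod_(l | l != j) ((-1) ^+ (j < l)%N * order_sign (t l) c) =
    (\prod_(l : 'I_k | l != j) (-1) ^+ (j < l)%N) * (-1) ^+ (#|L| + below L c).
  move=> cL; rewrite big_split /= -prod_order_sign //; congr (_ * _).
  have -> : L = t @: [set l | l != j].
    apply/setP => x; rewrite !inE; apply/andP/imsetP => [[xj /imsetP[l _ xl]]|].
      by exists l; rewrite // inE; apply: contraNneq xj => <-; rewrite xl.
    case=> l; rewrite inE => lj ->; split; first by rewrite (inj_eq ti).
    by apply: imset_f.
  rewrite big_imset /=; last by move=> x y _ _; apply: ti.
  by apply: eq_bigl => l; rewrite inE.
rewrite (inversion_sign_split t j) (inversion_sign_split _ j) -mulrA; congr (_ * _).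
  apply: eq_bigr => p /and3P[_ p1 p2]; rewrite /replace_entry !ffunE.
  by rewrite (negPf p1) (negPf p2).
transitivity (\prod_(l | l != j) ((-1) ^+ (j < l)%N * order_sign (t l) b)).
  by apply: eq_bigr => l lj; rewrite /replace_entry !ffunE eqxx (negPf lj).
rewrite !E // ?finset.setD11 // -mulrA; congr (_ * _); rewrite -!exprD.
rewrite -signr_odd -[RHS]signr_odd !oddD; congr (_ ^+ _).
by case: (odd _) (odd _) (odd _) => [] [] [].
Qed.

(** The quadratic Pluecker relations in their classical form, for sets K and L of
arbitrary sizes. *)
Definition plucker_relations (X : {set T} -> F) := forall K L : {set T},
  \sum_(a in K :\: L)
     (-1) ^+ (below K a + below L a) * (X (K :\ a) * X (a |: L)) = 0.

Lemma imset_replace k (t : {ffun 'I_k -> T}) j b : injective t ->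
  replace_entry t j b @: [set: 'I_k] = b |: (t @: [set: 'I_k]) :\ t j.
Proof.
move=> ti; apply/setP => x; rewrite !inE; apply/imsetP/orP => [[l _ ->]|].
  rewrite /replace_entry ffunE; case: (eqVneq l j) => [_|lj]; [by left; rewrite eqxx|right].
  by rewrite (inj_eq ti) lj imset_f.
case=> [/eqP->|/andP[xj /imsetP[l _ xl]]].
  by exists j; rewrite // /replace_entry ffunE eqxx.
exists l; rewrite // /replace_entry ffunE; case: eqVneq => // lj.
by rewrite xl lj eqxx in xj.
Qed.

Definition signed_coord (X : {set T} -> F) k (t : {ffun 'I_k -> T}) : F :=
  inversion_sign t * X (t @: [set: 'I_k]).

Lemma signed_coord_inj X k (t : {ffun 'I_k -> T}) : signed_coord X t != 0 -> injective t.
Proof.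
move=> t0 i j tij; apply/eqP; apply: contraNT t0 => ij.
by rewrite /signed_coord (inversion_sign_eq0 ij tij) mul0r.
Qed.

(** For alternating functions the relation with K = A + a and L = B - a, where a is
the entry t j, carries no signs: the term of b in K exchanges a and b. If t0 i
lies in B, then the second factor on the right has a repeated entry. *)
Lemma plucker_exchange X k (t0 t : {ffun 'I_k -> T}) j : plucker_relations X ->
  injective t0 -> injective t -> t j \notin t0 @: [set: 'I_k] ->
  signed_coord X t0 * signed_coord X t =
  \sum_i signed_coord X (replace_entry t0 i (t j)) *
          signed_coord X (replace_entry t j (t0 i)).
Proof.
move=> PX t0i ti; set a := t j; set A := t0 @: _ => aA.
set B := t @: [set: 'I_k].
have aB : a \in B by apply: imset_f.
pose K := a |: A; pose L := B :\ a.
have KLa : a \in K :\: L by rewrite !inE eqxx.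
have := PX K L; rewrite (bigD1 a) //=.
have -> : K :\ a = A by rewrite /K finset.setU1K.
have -> : a |: L = B by rewrite /L finset.setD1K.
have -> : \sum_(i in K :\: L | i != a)
     (-1) ^+ (below K i + below L i) * (X (K :\ i) * X (i |: L)) =
  \sum_(i | t0 i \notin B) (-1) ^+ (below K (t0 i) + below L (t0 i)) *
     (X (K :\ t0 i) * X (t0 i |: L)) :> F.
  rewrite -[RHS](big_imset (fun i => (-1) ^+ (below K i + below L i) *
     (X (K :\ i) * X (i |: L)))) /=; last by move=> x y _ _; apply: t0i.
  apply: eq_bigl => x; rewrite !inE; apply/idP/imsetP => [|[l iB0 ->]].
    case/andP => /andP[xL /orP[/eqP->|/imsetP[i _ xi]]]; first by rewrite eqxx.
    move=> xa; exists i => //; have -> : (i \in (fun i => t0 i \notin B)) = (t0 i \notin B) by [].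
    by rewrite -xi; move: xL; rewrite xa.
  have iB : t0 l \notin B := iB0.
  have ia : t0 l != a by apply: contraNneq aA => <-; apply: imset_f.
  by rewrite ia (negPf iB) imset_f ?orbT.
move=> E.
rewrite (bigID (fun i => t0 i \notin B)) /= [X in _ = _ + X]big1 ?addr0; last first.
  move=> i; rewrite negbK => /imsetP[l _ il].
  have lj : l != j.
    by apply: contraNneq aA => lj; rewrite /a -lj -il imset_f.
  rewrite /signed_coord [X in _ * (X * _)](@inversion_sign_eq0 _ _ l j) ?mul0r ?mulr0 //.
  by rewrite /replace_entry !ffunE eqxx (negPf lj).
have S i : t0 i \notin B ->
   signed_coord X (replace_entry t0 i a) * signed_coord X (replace_entry t j (t0 i)) =
   - (inversion_sign t0 * inversion_sign t * (-1) ^+ (below K a + below L a)) *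
   ((-1) ^+ (below K (t0 i) + below L (t0 i)) * (X (K :\ t0 i) * X (t0 i |: L))).
  move=> iB; set b := t0 i; have ba : b != a.
    by apply: contraNneq aA => <-; apply: imset_f.
  have bL : b \notin L by rewrite !inE negb_and iB orbT.
  have aA' : a \notin A :\ b by rewrite !inE negb_and aA orbT.
  rewrite /signed_coord !imset_replace // -/A -/B -/a -/b !inversion_sign_replace //.
  rewrite -/A -/B -/a -/b.
  have -> : a |: A :\ b = K :\ b.
    rewrite /K; apply/setP => x; rewrite !inE.
    by case: eqVneq => //= ->; rewrite eq_sym ba.
  rewrite -/L.
  set A' := A :\ b in aA' *.
  (* K consists of A', a and b; exactly one of a and b is below the other, and this
     extra unit reverses the sign *)
  have Ka : below K a = (below A' a + (r b < r a))%N.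
    rewrite /below (cardsD1 b) addnC; congr addn.
      apply: eq_card => x; rewrite !inE; case: (eqVneq x a) => [->|] /=.
        by rewrite ltnn !andbF.
      by rewrite andbA.
    by rewrite !inE imset_f // orbT.
  have Kb : below K b = (below A' b + (r a < r b))%N.
    rewrite /below (cardsD1 a) addnC; congr addn; last by rewrite !inE eqxx.
    apply: eq_card => x; rewrite !inE; case: (eqVneq x a) => [->|] /=.
      by rewrite (negPf aA) andbF.
    by case: (eqVneq x b) => [->|]; rewrite ?ltnn ?andbF.
  have := ba; rewrite -(inj_eq r_inj) => rab.
  have sE : (-1) ^+ (below A' b + below A' a) * (-1) ^+ (below L a + below L b) =
     - ((-1) ^+ (below K a + below L a) * (-1) ^+ (below K b + below L b)) :> F.
    rewrite -!exprD Ka Kb -[RHS]mulN1r -exprS -signr_odd -[RHS]signr_odd; congr (_ ^+ _).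
    rewrite /= !oddD !oddb.
    by move: rab; case: ltngtP => //= _ _; do 4!case: (odd _).
  by rewrite mulrACA [X in X * _]mulrACA sE mulrN !mulNr !mulrA.
rewrite (eq_bigr _ S) -mulr_sumr.
move/eqP: E; rewrite addrC addr_eq0 => /eqP->.
rewrite mulrNN /signed_coord mulrACA !mulrA; congr (_ * _ * _).
by rewrite -[RHS]mulrA -expr2 sqrr_sign mulr1.
Qed.

(** The column of M at a holds the values at t0 with one entry replaced by a, as in
Cramer's rule. By [plucker_exchange] and by cofactor expansion, both sides
expand in the same way along an entry outside t0, which reduces the number of
such entries; if there are none, then both sides are the sign of a permutation,
or zero. *)
Lemma plucker_minors X k (t0 : {ffun 'I_k -> T}) : plucker_relations X ->
  signed_coord X t0 != 0 ->
  exists M : 'I_k -> T -> F, forall t : {ffun 'I_k -> T},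
    signed_coord X t = signed_coord X t0 * \det (\matrix_(i, j) M i (t j)).
Proof.
move=> PX X0; have t0i := signed_coord_inj X0.
pose M i a := signed_coord X (replace_entry t0 i a) / signed_coord X t0.
have Mt0 i l : M i (t0 l) = (i == l)%:R.
  rewrite /M; case: eqVneq => [->|il].
    have -> : replace_entry t0 l (t0 l) = t0.
      by apply/ffunP => x; rewrite ffunE; case: eqVneq => // ->.
    by rewrite divff.
  rewrite /signed_coord (@inversion_sign_eq0 _ _ i l) ?mul0r //.
  by rewrite /replace_entry !ffunE eqxx eq_sym (negPf il).
exists M.
pose A := t0 @: [set: 'I_k].
suff H m (t : {ffun 'I_k -> T}) : (#|[set j | t j \notin A]| <= m)%N ->
   signed_coord X t = signed_coord X t0 * \det (\matrix_(i, j) M i (t j)).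
  by move=> t; apply: (H _ t (leqnn _)).
elim: m t => [|m IH] t.
- rewrite leqn0 cards_eq0 => /eqP t0A.
  have tA j : t j \in A.
    apply/negPn/negP => tj; have : j \in finset.set0 by rewrite -t0A inE.
    by rewrite inE.
  have /fin_all_exists[g tg] : forall j, exists l, t j = t0 l.
    by move=> j; have /imsetP[l _ ->] := tA j; exists l.
  case: (boolP (injectiveb g)) => [/injectiveP gi|/injectivePn[i [j ij gij]]].
    have -> : \matrix_(i, j) M i (t j) = perm_mx (perm gi)^-1.
      by apply/matrixP => i j; rewrite !mxE tg Mt0 (canF_eq (permKV _)) permE.
    rewrite det_perm odd_permV mulrC /signed_coord mulrA; congr (_ * X _).
      rewrite -inversion_sign_perm; apply: eq_bigr => i _; apply: eq_bigr => j _.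
      by rewrite !permE !tg.
    apply/setP => x; apply/imsetP/imsetP => [[i _ ->]|[i _ ->]].
      by exists (g i).
    by exists (invF gi i); rewrite // tg f_invF.
  have tij : t i = t j by rewrite !tg gij.
  rewrite /signed_coord (inversion_sign_eq0 ij tij) mul0r -det_tr.
  rewrite (determinant_alternate ij) ?mulr0 //.
  by move=> l; rewrite !mxE tij.
- move=> tm.
  case: (boolP (injectiveb t)) => [/injectiveP ti|/injectivePn[i [j ij tij]]]; last first.
    rewrite /signed_coord (inversion_sign_eq0 ij tij) mul0r -det_tr.
    rewrite (determinant_alternate ij) ?mulr0 //.
    by move=> l; rewrite !mxE tij.
  case: (set_0Vmem [set j | t j \notin A]) => [t0A|[j]].
    by apply: IH; rewrite t0A finset.cards0.
  rewrite inE => tj; apply: (mulfI X0).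
  rewrite (@plucker_exchange _ _ _ _ j) // (expand_det_col _ j) !mulr_sumr.
  apply: eq_bigr => i _.
  rewrite mxE; have -> : signed_coord X (replace_entry t0 i (t j)) = signed_coord X t0 * M i (t j).
    by rewrite /M mulrC divfK.
  rewrite -mulrA; congr (_ * _); rewrite [RHS]mulrCA; congr (_ * _).
  rewrite IH; last first.
    have /subset_leq_card :
        [set l | replace_entry t j (t0 i) l \notin A] \subset [set j | t j \notin A] :\ j.
      apply/fintype.subsetP => l; rewrite !inE /replace_entry ffunE; case: eqVneq => // _.
      by rewrite imset_f.
    move: tm; rewrite (cardsD1 j) inE tj add1n ltnS => tm; move=> H; exact: leq_trans H tm.
  congr (_ * _); rewrite (expand_det_col _ j) (bigD1 i) //= big1 ?addr0.
    rewrite !mxE /replace_entry ffunE eqxx Mt0 eqxx mul1r /cofactor; congr (_ * \det _).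
    apply/matrixP => p q; rewrite !mxE ffunE.
    by rewrite eq_sym (negPf (neq_lift _ _)).
  by move=> l li; rewrite !mxE ffunE eqxx Mt0 (negPf li) mul0r.
Qed.

End Signs.

(** * Identifying columns in pairs *)

Section Fold.
Variables (F : fieldType) (n : nat).

(** An equatorial vertex is cut into an upper slot (on the left of the sum) and a
lower slot. All upper slots precede all lower slots. *)
Definition slot : finType := ('I_n + 'I_n)%type.
Definition slot_rank (x : slot) : nat :=
  match x with inl i => i | inr i => (n + i)%N end.
Definition mkslot (lower : bool) (i : 'I_n) : slot := if lower then inr i else inl i.

Lemma slot_rank_inj : injective slot_rank.
Proof.
move=> [i|i] [j|j] /= ij.
- by congr inl; apply: val_inj.
- by have := ltn_ord i; rewrite ij ltnNge leq_addr.
- by have := ltn_ord j; rewrite -ij ltnNge leq_addr.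
- by congr inr; apply: val_inj; apply: (@addnI n).
Qed.

Definition upper_part (S : {set slot}) : {set 'I_n} := [set i | inl i \in S].
Definition lower_part (S : {set slot}) : {set 'I_n} := [set i | inr i \in S].

Definition lifts (I : {set 'I_n}) (S : {set slot}) :=
  [disjoint upper_part S & lower_part S] && (upper_part S :|: lower_part S == I).

(** The Pluecker coordinates of the image under the linear map that sends the two
basis vectors at the slots of vertex i to the i-th basis vector. *)
Definition fold_slots (X : {set slot} -> F) (I : {set 'I_n}) : F :=
  \sum_(S | lifts I S) (-1) ^+ inversions (upper_part S) (lower_part S) * X S.

Lemma det_sum_cols k (M : bool -> 'M[F]_k) :
  \det (\matrix_(i, j) \sum_b M b i j) =
  \sum_(g : {ffun 'I_k -> bool}) \det (\matrix_(i, j) M (g j) i j).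
Proof.
rewrite -det_tr /determinant.
under eq_bigr => s _.
  under eq_bigr => i _ do rewrite !mxE.
  rewrite bigA_distr_bigA mulr_sumr; over.
rewrite exchange_big; apply: eq_bigr => g _ /=.
rewrite -[RHS]det_tr; apply: eq_bigr => s _; congr (_ * _).
by apply: eq_bigr => i _; rewrite !mxE.
Qed.

Section Enum.
Variables (k : nat) (e : 'I_k -> 'I_n).
Hypothesis e_mono : forall i j : 'I_k, (i < j)%N -> (e i < e j)%N.

Definition lift_seq (g : {ffun 'I_k -> bool}) : {ffun 'I_k -> slot} :=
  [ffun j => mkslot (g j) (e j)].

Let e_lt i j : (e i < e j)%N = (i < j)%N.
Proof.
case: (ltngtP i j) => ij; first exact: e_mono.
  by apply/negbTE; rewrite -leqNgt ltnW // e_mono.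
by rewrite (val_inj ij) ltnn.
Qed.

Let e_inj : injective e.
Proof.
move=> i j ij; case: (ltngtP i j) => [lij|lij|/val_inj //].
  by have := e_mono lij; rewrite ij ltnn.
by have := e_mono lij; rewrite ij ltnn.
Qed.

Lemma lift_seqE g b i : (mkslot b (e i) \in lift_seq g @: [set: 'I_k]) = (g i == b).
Proof.
apply/imsetP/eqP => [[j _]|<-]; last by exists i; rewrite // ffunE.
rewrite ffunE; case: b; case gj: (g j) => //= -[] /e_inj ->; exact: gj.
Qed.

Lemma sum_lifts (H : {set slot} -> F) (I := e @: [set: 'I_k]) :
  \sum_(S | lifts I S) H S =
  \sum_(g : {ffun 'I_k -> bool}) H (lift_seq g @: [set: 'I_k]).
Proof.
rewrite (reindex_onto (fun g : {ffun 'I_k -> bool} => lift_seq g @: [set: 'I_k])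
   (fun S => [ffun j => inr (e j) \in S])) /=.
  apply: eq_bigl => g; apply/andP; split; last first.
    apply/eqP/ffunP => j; rewrite ffunE.
    by rewrite -[inr _]/(mkslot true _) lift_seqE eqb_id.
  apply/andP; split.
    rewrite -finset.setI_eq0; apply/eqP/setP => i; rewrite !inE; apply/negbTE/negP.
    case/andP => /imsetP[j _ ij] /imsetP[l _].
    move: ij; rewrite !ffunE; case gj: (g j); case gl: (g l) => //= -[->] [/e_inj jl].
    by rewrite jl gl in gj.
  apply/eqP/setP => i; rewrite !inE; apply/orP/imsetP.
    by case=> /imsetP[j _]; rewrite ffunE; case: (g j) => //= -[ij]; exists j; rewrite ?inE.  
  case=> j _ ->; rewrite -[inl _]/(mkslot false _) -[inr _]/(mkslot true _) !lift_seqE.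
  by case: (g j); [right|left].
move=> S /andP[dS /eqP SI]; apply/setP => x.
have eI i : i \in I -> exists j, i = e j by case/imsetP => j _ ->; exists j.
have nS i : (inl i \in S) = (i \in I) && (inr i \notin S).
  rewrite -SI !inE; case iS: (inl i \in S) => /=; last by case: (inr _ \in _).
  apply/esym/negP => iS'; move/pred0P: dS => /(_ i) /=.
  by rewrite !inE iS iS'.
case xS: (x \in S).
  have [j [b xE]] : exists j b, x = mkslot b (e j).
    case: x xS => i iS.
      have /eI[j ->] : i \in I by rewrite -SI !inE iS.
      by exists j, false.
    have /eI[j ->] : i \in I by rewrite -SI !inE iS orbT.
    by exists j, true.
  rewrite xE lift_seqE ffunE; rewrite xE in xS.
  by case: b xE xS => /= _ => [->|]; rewrite // nS => /andP[_ /negPf->].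
apply/negP => /imsetP[j _ xE]; move: xS; rewrite xE !ffunE.
case jS: (inr (e j) \in S) => /=; rewrite ?jS // nS jS andbT imset_f //.
Qed.

(** For i < j the slots over e i and e j form an inversion exactly if the first is
lower and the second is upper, and then (e j, e i) is one of the pairs counted
by [inversions]. *)
Lemma lift_seq_sign g (S := lift_seq g @: [set: 'I_k]) :
  (-1) ^+ inversions (upper_part S) (lower_part S) =
  inversion_sign slot_rank F (lift_seq g).
Proof.
rewrite /inversion_sign pair_big_dep /=.
transitivity (\prod_(p : 'I_k * 'I_k | (p.1 < p.2)%N)
    (-1) ^+ (slot_rank (lift_seq g p.2) < slot_rank (lift_seq g p.1))%N : F); last first.
  apply: eq_bigr => p p12; rewrite /order_sign; case: eqVneq => // E.
  have : e p.1 = e p.2 by move: E; rewrite !ffunE; case: (g _); case: (g _) => //= -[].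
  by move/e_inj => E'; rewrite E' ltnn in p12.
rewrite (bigID (fun p => slot_rank (lift_seq g p.2) < slot_rank (lift_seq g p.1))%N) /=.
rewrite [X in _ = _ * X]big1 ?mulr1; last by move=> p /andP[_ /negPf->].
rewrite (eq_bigr (fun _ => -1)); last by move=> p /andP[_ ->].
rewrite prodr_const; congr (_ ^+ _); rewrite /inversions.
pose B := [set p : 'I_k * 'I_k |
  (p.1 < p.2)%N && (slot_rank (lift_seq g p.2) < slot_rank (lift_seq g p.1))%N].
rewrite [RHS](_ : _ = #|B|); last by apply: eq_card => p; rewrite !inE.
transitivity #|[set (e p.2, e p.1) | p in B]|; last first.
  by rewrite card_imset // => -[p1 p2] [q1 q2] /= [/e_inj-> /e_inj->].
apply: eq_card => -[a b]; rewrite !inE /=; apply/and3P/imsetP.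
  case=> /imsetP[j _]; rewrite ffunE; case gj: (g j) => //= -[->].
  case/imsetP=> i _; rewrite ffunE; case gi: (g i) => //= -[->].
  rewrite e_lt => ij; exists (i, j) => //=.
  rewrite inE /= ij /= !ffunE gi gj /=; exact: ltn_addr.
case=> -[i j]; rewrite inE /= => /andP[ij]; rewrite !ffunE => R [-> ->].
move: R; rewrite -[inl _]/(mkslot false _) -[inr _]/(mkslot true _) !lift_seqE.
have ei := ltn_ord (e i); have eij := e_mono ij.
case: (g i); case: (g j) => /=; rewrite ?ltn_add2l; try by lia.
  by move=> _; split.
Qed.

Lemma fold_slots_signed X : fold_slots X (e @: [set: 'I_k]) =
  \sum_(g : {ffun 'I_k -> bool}) signed_coord slot_rank X (lift_seq g).
Proof.
by rewrite /fold_slots sum_lifts; apply: eq_bigr => g _; rewrite lift_seq_sign.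
Qed.

End Enum.

Definition sorted_elt k (I : {set 'I_n}) (cardI : #|I| = k) (j : 'I_k) : 'I_n :=
  enum_val (cast_ord (esym cardI) j).

Lemma sorted_elt_mono k (I : {set 'I_n}) (cardI : #|I| = k) (i j : 'I_k) :
  (i < j)%N -> (sorted_elt cardI i < sorted_elt cardI j)%N.
Proof.
move=> ij; have srt : sorted (fun a b : 'I_n => a < b)%N (enum I).
  rewrite /enum_mem -enumT; apply: sorted_filter.
    by move=> a b c; apply: ltn_trans.
  by have := iota_ltn_sorted 0 n; rewrite -val_enum_ord sorted_map.
have i0 : 'I_n := sorted_elt cardI i.
have tr : transitive (fun a b : 'I_n => a < b)%N by move=> a b c; apply: ltn_trans.
rewrite /sorted_elt !(enum_val_nth i0).
by apply: (sorted_ltn_nth tr i0 srt); rewrite // inE -cardE ltn_ord.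
Qed.

Lemma sorted_elt_imset k (I : {set 'I_n}) (cardI : #|I| = k) :
  sorted_elt cardI @: [set: 'I_k] = I.
Proof.
apply/setP => i; apply/imsetP/idP => [[j _ ->]|iI]; first exact: enum_valP.
exists (cast_ord cardI (enum_rank_in iI i)) => //.
by rewrite /sorted_elt cast_ordK enum_rankK_in.
Qed.

Lemma vbasis_coords (V : {vspace 'rV[F]_n}) k (A : 'M[F]_(k, n)) : \dim V = k ->
  (forall i, row i A \in V) ->
  exists C : 'M[F]_k, A = C *m \matrix_(i < k) (vbasis V)`_i.
Proof.
move=> dV; case: _ / dV A => A AV.
exists (\matrix_(i, j) coord (vbasis V) j (row i A)).
apply/row_matrixP => i; rewrite row_mul mulmx_sum_row {1}(coord_vbasis (AV i)).
by apply: eq_bigr => j _; rewrite rowK !mxE.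
Qed.

(** One nonzero minor makes the rows of A independent, hence a basis of their span.
The change to the chosen basis multiplies all minors by the same determinant. *)
Lemma minors_Grassmannian k (A : 'M[F]_(k, n)) (c : F) (Y : {set 'I_n} -> F) :
  (forall (I : {set 'I_n}) (cardI : #|I| = k),
     Y I = c * \det (\matrix_(i, j) A i (sorted_elt cardI j))) ->
  (exists2 I : {set 'I_n}, #|I| = k & Y I != 0) -> Grassmannian_point k Y.
Proof.
move=> YA [I0 cI0]; rewrite (YA _ cI0) mulf_eq0 negb_or => /andP[c0 dA].
pose V := <<[seq row i A | i <- enum 'I_k]>>%VS.
have sub (B : 'M[F]_(k, n)) (I : {set 'I_n}) (cI : #|I| = k) :
    \matrix_(i, j) B i (sorted_elt cI j) = colsub (sorted_elt cI) B.
  by apply/matrixP => i j; rewrite !mxE.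
have AV i : row i A \in V by apply/memv_span/map_f; rewrite mem_enum.
have dimV : \dim V = k.
  have sz : size [seq row i A | i <- enum 'I_k] = k by rewrite size_map size_enum_ord.
  suff : free [seq row i A | i <- enum 'I_k] by rewrite /free sz => /eqP.
  have -> : [seq row i A | i <- enum 'I_k] = [tuple row i A | i < k] by [].
  apply/freeP => a aA i.
  suff a0 : \row_i a i = 0 by have := congr1 (fun M : 'rV_k => M 0 i) a0; rewrite !mxE.
  have U : colsub (sorted_elt cI0) A \in unitmx by rewrite unitmxE unitfE -sub.
  apply: (can_inj (mulmxK U)); rewrite mul0mx.
  have aA0 : (\row_i a i) *m A = 0.
    rewrite mulmx_sum_row -[RHS]aA; apply: eq_bigr => j _.
    by rewrite mxE -tnth_nth tnth_mktuple.
  apply/rowP => j; have E := congr1 (fun M : 'rV_n => M 0 (sorted_elt cI0 j)) aA0.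
  rewrite [LHS]mxE [RHS]mxE; move: E; rewrite [X in X = _ -> _]mxE [X in _ = X -> _]mxE => E.
  by rewrite -[RHS]E; apply: eq_bigr => l _; rewrite !mxE.
have [C AC] := vbasis_coords dimV AV.
have E (I : {set 'I_n}) (cI : #|I| = k) : \det (\matrix_(i, j) A i (sorted_elt cI j)) =
    \det C * plucker_coord V cI.
  rewrite sub AC /plucker_coord -det_mulmx; congr (\det _).
  apply/matrixP => i j; rewrite !mxE; apply: eq_bigr => l _; congr (_ * _).
  by rewrite !mxE.
exists V => //; exists (c * \det C).
  rewrite mulf_neq0 //; apply: contraNneq dA => C0.
  by rewrite E C0 mul0r.
by move=> I cI; rewrite (YA _ cI) E mulrA.
Qed.

(** If X consists of the minors of M, then its fold consists of the minors of the
matrix obtained by adding the two columns of M at the slots of each vertex: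
expand these minors column by column. *)
Lemma fold_slots_Grassmannian k (X : {set slot} -> F) : plucker_relations slot_rank X ->
  (exists2 I : {set 'I_n}, #|I| = k & fold_slots X I != 0) ->
  Grassmannian_point k (fold_slots X).
Proof.
move=> PX Y0; have [I0 cI0 YI0] := Y0.
have foldE (I : {set 'I_n}) (cI : #|I| = k) : fold_slots X I =
    \sum_(g : {ffun 'I_k -> bool}) signed_coord slot_rank X (lift_seq (sorted_elt cI) g).
  by rewrite -fold_slots_signed ?sorted_elt_imset //; apply: sorted_elt_mono.
have [g g0] : exists g, signed_coord slot_rank X (lift_seq (sorted_elt cI0) g) != 0.
  apply/existsP; apply: contraNT YI0; rewrite negb_exists => /forallP z.
  by rewrite (foldE _ cI0) big1 // => g _; apply/eqP; rewrite -[_ == _]negbK z.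
have [M ME] := plucker_minors slot_rank_inj PX g0.
apply: (@minors_Grassmannian k (\matrix_(i, a) \sum_b M i (mkslot b a)) _ _ _ Y0) => I cI.
rewrite (foldE _ cI); under eq_bigr do rewrite ME.
rewrite -mulr_sumr; congr (_ * _).
transitivity (\det (\matrix_(i, j)
    \sum_b (\matrix_(i', j') M i' (mkslot b (sorted_elt cI j'))) i j)).
  rewrite det_sum_cols; apply: eq_bigr => h _; congr (\det _).
  by apply/matrixP => i j; rewrite !mxE ffunE.
congr (\det _); apply/matrixP => i j; rewrite !mxE; apply: eq_bigr => b _.
by rewrite !mxE.
Qed.

End Fold.

(** * Double dimers *)

Lemma sum_sign_reversing (I : finType) (F : numFieldType) (P : pred I) (G : I -> F)
    (phi : I -> I) :
  (forall i, P i -> [/\ P (phi i), phi (phi i) = i & G (phi i) = - G i]) ->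
  \sum_(i | P i) G i = 0.
Proof.
move=> H; suff : (\sum_(i | P i) G i) *+ 2 == 0 by rewrite mulrn_eq0 => /eqP.
rewrite mulr2n {1}(reindex_onto phi phi) /=; last by move=> i /H[].
rewrite [X in X + _](eq_bigl P) => [|i].
  by rewrite -big_split big1 //= => i /H[_ _ ->]; rewrite addNr.
apply/andP/idP => [[Pi /eqP i2]|/H[? /eqP ? _]//].
by rewrite -i2; case: (H _ Pi).
Qed.

(** The elements that f moves up in the order r are as many as those that it moves
down. *)
Lemma even_card_involution (T : finType) (Z : {set T}) (r : T -> nat) (f : T -> T) :
  injective r -> (forall x, x \in Z -> [/\ f x \in Z, f (f x) = x & f x != x]) ->
  ~~ odd #|Z|.
Proof.
move=> ri H; pose A := [set x in Z | (r x < r (f x))%N].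
have fi : {in A &, injective f}.
  move=> x y; rewrite !inE => /andP[/H[_ fx _] _] /andP[/H[_ fy _] _] fxy.
  by rewrite -fx fxy fy.
suff -> : Z = A :|: f @: A.
  rewrite finset.cardsU card_in_imset // (_ : A :&: f @: A = finset.set0).
    by rewrite finset.cards0 subn0 addnn odd_double.
  apply/setP => x; rewrite !inE; apply/negP => /andP[/andP[xZ xf] /imsetP[y]].
  rewrite inE => /andP[yZ yf] xE; move: xf; rewrite xE.
  by case: (H _ yZ) => _ -> _; rewrite ltnNge ltnW.
apply/setP => x; rewrite !inE; apply/idP/orP => [xZ|[/andP[]//|/imsetP[y]]].
  have [fZ f2 fx] := H _ xZ; move: fx; rewrite -(inj_eq ri) neq_ltn => /orP[lt|lt].
    right; apply/imsetP; exists (f x); rewrite ?inE ?f2 //.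
    by rewrite fZ lt.
  by left; rewrite xZ.
by rewrite inE => /andP[/H[fZ _ _] _] ->.
Qed.

Section SymD.
Variable T : finType.
Definition symD (A B : {set T}) : {set T} := (A :\: B) :|: (B :\: A).

Lemma in_symD A B x : (x \in symD A B) = (x \in A) (+) (x \in B).
Proof. by rewrite !inE; case: (x \in A); case: (x \in B). Qed.

Lemma symDC A B : symD A B = symD B A.
Proof. by rewrite /symD finset.setUC. Qed.

Lemma symDK C A : symD (symD A C) C = A.
Proof. by apply/setP => x; rewrite !in_symD -addbA addbb addbF. Qed.

Lemma symD2 A B C : symD (symD A C) (symD B C) = symD A B.
Proof.
by apply/setP => x; rewrite !in_symD; case: (x \in A) (x \in B) (x \in C) => [] [] [].
Qed.

Lemma card_symD A B : odd #|symD A B| = odd (#|A| + #|B|)%N.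
Proof.
rewrite finset.cardsU (_ : (A :\: B) :&: (B :\: A) = finset.set0); last first.
  by apply/setP => x; rewrite !inE; case: (x \in A); rewrite ?andbF ?andbT //=; case: (x \in B).
rewrite finset.cards0 subn0 -(cardsID B A) -(cardsID A B) finset.setIC !oddD.
by case: (odd _) (odd _) (odd _) => [] [] [].
Qed.
End SymD.

Section Mate.
Variables (E : finType) (R : rel E).
Hypothesis R_sym : symmetric R.
Hypothesis R_tr : transitive R.

(** R is a partial equivalence relation, whose classes are the stars of the vertices
of one colour. In the symmetric difference of two transversals a class has two
elements or none, and the mate is the other one; elements that belong to no
class are their own mates. *)
Definition mate (D : {set E}) e :=
  odflt e [pick x | [&& e \in D, x \in D, x != e & R e x]].

Definition transverse (P : {set E}) :=
  (forall e e', e \in P -> e' \in P -> R e e' -> e = e') /\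
  (forall e, R e e -> exists2 p, p \in P & R e p).

Variables P Q : {set E}.
Hypothesis (tP : transverse P) (tQ : transverse Q).
Let D := symD P Q.

Lemma mate_unique e x : e \in D -> x \in D -> x != e -> R e x -> mate D e = x.
Proof.
have U (A B : {set E}) : transverse A -> transverse B -> forall e x y,
    e \in A :\: B -> x \in symD A B -> y \in symD A B -> x != e -> y != e ->
    R e x -> R e y -> x = y.
  move=> [uA _] [uB _] {}e {}x y; rewrite !inE => /andP[eB eA] xD yD xe ye ex ey.
  have nA z : z != e -> R e z -> z \notin A.
    by move=> ze ez; apply: contraNN ze => zA; apply/eqP/esym/uA.
  move: xD yD; rewrite !(negPf (nA _ _ _)) // !andbF /= => xB yB.
  by apply: uB => //; apply: R_tr ey; rewrite R_sym.
move=> eD xD xe ex; rewrite /mate; case: pickP => [y /and4P[_ yD ye ey] /=|/(_ x)].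
  move: eD; rewrite inE => /orP[] eD; first exact: (U P Q tP tQ e).
  by apply: (U Q P tQ tP e); rewrite // symDC.
by rewrite eD xD xe ex.
Qed.

Lemma mate_free e : ~~ (R e e) -> mate D e = e.
Proof.
move=> ee; rewrite /mate; case: pickP => //= x /and4P[_ _ _ ex].
by rewrite (R_tr ex) // R_sym in ee.
Qed.

Lemma mate_out e : e \notin D -> mate D e = e.
Proof. by move=> eD; rewrite /mate; case: pickP => //= x /and4P[]; rewrite (negPf eD). Qed.

Lemma mate_exists (A B : {set E}) e : transverse A -> transverse B -> e \in A :\: B -> R e e ->
  exists2 x, x \in B :\: A & R e x /\ x != e.
Proof.
move=> [uA _] [uB eB]; rewrite inE => /andP[enB eA] ee.
have [x xB ex] := eB _ ee; have xe : x != e by apply: contraNneq enB => <-.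
exists x => //; rewrite inE xB andbT; apply: contraNN xe => xA.
by apply/eqP/esym/uA.
Qed.

Lemma mateP e : e \in P :\: Q -> R e e -> mate D e \in Q :\: P /\ R e (mate D e).
Proof.
move=> eP ee; have [x xQ [ex xe]] := mate_exists tP tQ eP ee.
suff -> : mate D e = x by [].
by apply: mate_unique; rewrite // /D /symD inE ?eP ?xQ ?orbT.
Qed.

End Mate.

Section MateSym.
Variables (E : finType) (R : rel E).
Hypothesis R_sym : symmetric R.
Hypothesis R_tr : transitive R.
Variables P Q : {set E}.
Hypothesis (tP : transverse R P) (tQ : transverse R Q).
Let D := symD P Q.

Lemma mateQ e : e \in Q :\: P -> R e e -> mate R D e \in P :\: Q /\ R e (mate R D e).
Proof. by rewrite /D symDC; apply: mateP. Qed.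

Lemma mate_in e : e \in D -> R e e ->
  [/\ mate R D e \in D, mate R D e != e & R e (mate R D e)].
Proof.
rewrite /D inE => /orP[] eD ee.
  have [mD em] := mateP R_sym R_tr tP tQ eD ee; split=> //; first by rewrite inE mD orbT.
  by apply: contraTneq mD => ->; move: eD; rewrite !inE; case: (e \in P) (e \in Q) => [] [].
have [mD em] := mateQ eD ee; split=> //; first by rewrite inE mD.
by apply: contraTneq mD => ->; move: eD; rewrite !inE; case: (e \in P) (e \in Q) => [] [].
Qed.

Lemma mateK : involutive (mate R D).
Proof.
move=> e; case: (boolP (e \in D)) => eD; last by rewrite !mate_out.
case: (boolP (R e e)) => ee; last by rewrite !mate_free.
have [mD me em] := mate_in eD ee.
by apply: mate_unique => //; rewrite 1?eq_sym // R_sym.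
Qed.

End MateSym.

(** The setting is a bipartite graph with boundary: wh and bl give the white and
the black end of an edge, WS and BS are the sets of white and of interior black
vertices. An edge whose black end is not in BS ends at a boundary slot, named by
sl, and no other edge ends there. *)
Section DoubleDimer.
Variables (E V T : finType) (F : numFieldType) (r : T -> nat).
Hypothesis r_inj : injective r.
Variables (wh bl : E -> V) (WS BS : {set V}) (sl : E -> option T) (wt : E -> F).
Hypothesis wh_WS : forall e, wh e \in WS.
Hypothesis sl_BS : forall e, (sl e == None) = (bl e \in BS).
Hypothesis sl_inj : forall e e' t, sl e = Some t -> sl e' = Some t -> e = e'.

Definition sameW : rel E := fun e e' => wh e == wh e'.
Definition sameB : rel E := fun e e' => (bl e \in BS) && (bl e == bl e').

Definition adj (D : {set E}) : rel E := fun e e' =>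
  [&& e \in D, e' \in D & sameW e e' || sameB e e'].

Definition perfect (P : {set E}) :=
  [forall v in WS, #|[set e in P | wh e == v]| == 1%N] &&
  [forall v in BS, #|[set e in P | bl e == v]| == 1%N].

Definition slots (P : {set E}) : {set T} := [set t | [exists e in P, sl e == Some t]].

Definition matching_sum (S : {set T}) : F :=
  \sum_(P | perfect P && (slots P == S)) \prod_(e in P) wt e.

Let sW_sym : symmetric sameW. Proof. by move=> x y; apply: eq_sym. Qed.
Let sW_tr : transitive sameW. Proof. by move=> y x z /eqP xy; rewrite /sameW xy. Qed.
Let sB_sym : symmetric sameB.
Proof. by move=> x y; rewrite /sameB eq_sym; case: eqVneq => [->|]; rewrite ?andbF. Qed.
Let sB_tr : transitive sameB.
Proof.
move=> x y z; rewrite /sameB => /andP[yB /eqP yx] /andP[_ /eqP xz].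
by rewrite yB yx xz eqxx.
Qed.

Lemma adj_sym D : symmetric (adj D).
Proof.
by move=> x y; rewrite /adj sW_sym sB_sym; case: (x \in D); case: (y \in D).
Qed.

Lemma connect_adj_sym D : connect_sym (adj D).
Proof. by apply: sym_connect_sym; apply: adj_sym. Qed.

Lemma perfectW P : perfect P -> transverse sameW P.
Proof.
case/andP=> /forallP pW _.
have {}pW v : v \in WS -> exists p, [set e in P | wh e == v] = [set p].
  by move=> vW; apply/cards1P; apply: implyP (pW v) vW.
split=> [e e' eP e'P ee'|e _].
  have [p pE] := pW _ (wh_WS e).
  have : e \in [set p] by rewrite -pE inE eP eqxx.
  have : e' \in [set p] by rewrite -pE inE e'P eq_sym.
  by rewrite !inE => /eqP-> /eqP->.
have [p pE] := pW _ (wh_WS e); have : p \in [set p] by rewrite inE.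
by rewrite -pE inE => /andP[pP pe]; exists p; rewrite // /sameW eq_sym.
Qed.

Lemma perfectB P : perfect P -> transverse sameB P.
Proof.
case/andP=> _ /forallP pB.
have {}pB v : v \in BS -> exists p, [set e in P | bl e == v] = [set p].
  by move=> vB; apply/cards1P; apply: implyP (pB v) vB.
split=> [e e' eP e'P /andP[eB ee']|e /andP[eB _]].
  have [p pE] := pB _ eB.
  have : e \in [set p] by rewrite -pE inE eP eqxx.
  have : e' \in [set p] by rewrite -pE inE e'P eq_sym.
  by rewrite !inE => /eqP-> /eqP->.
have [p pE] := pB _ eB; have : p \in [set p] by rewrite inE.
by rewrite -pE inE => /andP[pP pe]; exists p; rewrite // /sameB eB eq_sym.
Qed.

Lemma iter_eq_order (f : E -> E) x n : injective f ->
  iter n f x = x -> (0 < n < 2 * fingraph.order f x)%N -> n = fingraph.order f x.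
Proof.
move=> fi nx /andP[n0 n2]; case: (ltnP n (fingraph.order f x)) => nm.
  by have := findex_iter nm; rewrite nx findex0 => n00; rewrite -n00 ltnn in n0.
have nE : n = (n - fingraph.order f x + fingraph.order f x)%N by rewrite subnK.
have : iter (n - fingraph.order f x) f x = x.
  by apply: etrans nx; rewrite [in RHS]nE iterD iter_order.
have lt : (n - fingraph.order f x < fingraph.order f x)%N by rewrite ltn_subLR // addnn -mul2n.
have := findex_iter lt => + E1; rewrite E1 findex0 => /esym/eqP.
by rewrite subn_eq0 => le; apply/eqP; rewrite eqn_leq le nm.
Qed.

(** Let al and be move an edge of D to its mate at the white and at the interior
black end. The boundary edge e0 is fixed by be, so its component is the orbit of
e0 under g = be al, and be acts on it by inverting the exponent of g. Since al
fixes no edge of D, the length m of the orbit is even, and the edges fixed by be,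
which are the boundary edges, are those with exponents 0 and m/2. *)
Lemma path_ends P Q e0 (D := symD P Q) : perfect P -> perfect Q ->
  e0 \in Q :\: P -> bl e0 \notin BS ->
  exists f, [/\ f \in P :\: Q, bl f \notin BS, connect (adj D) e0 f &
    forall x, connect (adj D) e0 x -> bl x \notin BS -> x = e0 \/ x = f].
Proof.
move=> pP pQ e0Q e0B.
have [tPW tQW tPB tQB] : [/\ transverse sameW P, transverse sameW Q,
  transverse sameB P & transverse sameB Q].
  by split; [apply: perfectW|apply: perfectW|apply: perfectB|apply: perfectB].
pose al := mate sameW D; pose be := mate sameB D.
have alK : involutive al by apply: mateK.
have beK : involutive be by apply: mateK.
pose g x := be (al x).
have gi : injective g by apply: inj_comp; apply: inv_inj.
have iti n : injective (iter n g) by elim: n => [|n IH] x y //= /gi/IH.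
have sWx x : sameW x x by apply: eqxx.
have be_free x : bl x \notin BS -> be x = x.
  by move=> xB; apply: mate_free; rewrite // /sameB negb_and xB.
have e0D : e0 \in D by rewrite /D inE e0Q orbT.
(* be (g^i e0) = g^(-i) e0 *)
have refl1 i : iter i g (be (iter i g e0)) = e0.
  elim: i => [|i IH] /=; first by apply: be_free.
  by rewrite -iterS iterSr /g beK alK.
(* al (g^i e0) = g^(-i-1) e0 *)
have refl2 i : iter i.+1 g (al (iter i g e0)) = e0.
  by have := refl1 i.+1; rewrite /= {2}/g beK.
pose m := fingraph.order g e0.
have itD i : iter i g e0 \in D.
  elim: i => //= i IH; rewrite {1}/g.
  have [aD _ _] := mate_in sW_sym sW_tr tPW tQW IH (sWx _).
  case: (boolP (sameB (al (iter i g e0)) (al (iter i g e0)))) => bb.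
    by have [] := mate_in sB_sym sB_tr tPB tQB aD bb.
  by rewrite /be mate_free.
have al_neq i : al (iter i g e0) != iter i g e0.
  by have [] := mate_in sW_sym sW_tr tPW tQW (itD i) (sWx _).
have m0 : (0 < m)%N by apply: fingraph.order_gt0.
have modd : ~~ odd m.
  apply/negP => mo; have mE := odd_double_half m; rewrite mo add1n -addnn in mE.
  have := refl2 m./2; rewrite -[RHS](iter_order gi e0) -/m -[in RHS]mE -addSn iterD.
  by move/iti/eqP; rewrite (negPf (al_neq _)).
have mE : m = (m./2 + m./2)%N by rewrite addnn -[LHS]odd_double_half (negPf modd).
have h0 : (0 < m./2)%N by move: m0; rewrite {1}mE addn_gt0 orbb.
have bfix i : (i < m)%N -> be (iter i g e0) = iter i g e0 -> i = 0%N \/ i = m./2.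
  move=> im bi; case: (posnP i) => i0; [by left|right].
  have := refl1 i; rewrite bi -iterD => ii.
  have : (i + i = m)%N.
    apply: iter_eq_order => //; rewrite addn_gt0 i0 /=.
    by rewrite -/m; lia.
  by rewrite addnn => <-; rewrite doubleK.
have fE : be (iter m./2 g e0) = iter m./2 g e0.
  apply: (iti m./2); rewrite refl1 -iterD -mE.
  by rewrite /m iter_order.
have itQ i : (i < m./2)%N -> iter i g e0 \in Q :\: P.
  elim: i => //= i IH im; have iQ := IH (ltnW im).
  have [aP _] := mateQ sW_sym sW_tr tPW tQW iQ (sWx _).
  rewrite -/D -/al in aP; rewrite {1}/g.
  case: (boolP (sameB (al (iter i g e0)) (al (iter i g e0)))) => bb.
    by have [] := mateP sB_sym sB_tr tPB tQB aP bb.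
  have gE : be (al (iter i g e0)) = al (iter i g e0) by apply: mate_free.
  case: (bfix i.+1) => //=; rewrite ?/g ?beK ?gE //.
  - by apply: leq_trans im _; rewrite {2}mE leq_addr.
  - by move=> iE; move: im; rewrite -iE ltnn.
set f := iter m./2 g e0 in fE.
have fP : f \in P :\: Q.
  have hE : m./2 = (m./2).-1.+1 by rewrite prednK.
  have lt : ((m./2).-1 < m./2)%N by rewrite -hE.
  have yQ := itQ _ lt.
  have [aP _] := mateQ sW_sym sW_tr tPW tQW yQ (sWx _).
  suff -> : f = al (iter (m./2).-1 g e0) by [].
  rewrite -fE /f hE /= {1}/g beK. by [].
have fB : bl f \notin BS.
  apply/negP => fB; have ff : sameB f f by rewrite /sameB fB eqxx.
  have fD : f \in D by apply: itD.
  by have [_ + _] := mate_in sB_sym sB_tr tPB tQB fD ff; rewrite -/D -/be fE eqxx.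
have conn i : connect (adj D) e0 (iter i g e0).
  elim: i => //= i IH; apply: connect_trans IH _.
  have [aD _ aW] := mate_in sW_sym sW_tr tPW tQW (itD i) (sWx _).
  apply: (@connect_trans _ _ (al (iter i g e0))).
    by apply: connect1; rewrite /adj itD aD aW.
  change (connect (adj D) (al (iter i g e0)) (be (al (iter i g e0)))).
  case: (boolP (sameB (al (iter i g e0)) (al (iter i g e0)))) => bb.
    have [bD _ bB] := mate_in sB_sym sB_tr tPB tQB aD bb.
    by apply: connect1; rewrite /adj aD bD bB orbT.
  by rewrite /be mate_free.
have orb x : connect (adj D) e0 x -> fconnect g e0 x.
  suff cl : fingraph.closed (adj D) (fconnect g e0).
    by move=> e0x; have := closed_connect cl e0x; rewrite -!topredE /= connect0 => /esym.
  apply: intro_closed; first by apply: connect_adj_sym.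
  move=> u y uy; rewrite -!topredE /= => /iter_findex uE.
  have sym := fconnect_sym gi.
  have beI i : fconnect g e0 (be (iter i g e0)).
    by rewrite sym -{2}(refl1 i) fconnect_iter.
  have alI i : fconnect g e0 (al (iter i g e0)).
    by rewrite sym -{2}(refl2 i) fconnect_iter.
  move: uy => /and3P[uD yD]; case: (eqVneq y u) => [->|yu].
    by rewrite -uE fconnect_iter.
  case/orP=> R.
    by rewrite -(mate_unique sW_sym sW_tr tPW tQW uD yD yu R) -uE; apply: alI.
  by rewrite -(mate_unique sB_sym sB_tr tPB tQB uD yD yu R) -uE; apply: beI.
exists f; split=> //; first exact: conn.
move=> x /orb cx xB; have xE := iter_findex cx.
have := bfix _ (findex_max cx); rewrite xE be_free // => /(_ erefl)[i0|ih].
  by left; rewrite -xE i0.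
by right; rewrite -xE ih.
Qed.

Lemma slots_symD P Q : slots (symD P Q) = symD (slots P) (slots Q).
Proof.
have S (A : {set E}) e t : sl e = Some t -> (t \in slots A) = (e \in A).
  move=> et; rewrite inE; apply/exists_inP/idP => [[x xA /eqP xt]|eA].
    by rewrite (sl_inj et xt).
  by exists e; rewrite ?et.
have N (A : {set E}) t : ~~ [exists e, sl e == Some t] -> t \notin slots A.
  apply: contraNN; rewrite inE => /exists_inP[e _ et]; by apply/existsP; exists e.
apply/setP => t; rewrite in_symD.
case: (boolP [exists e, sl e == Some t]) => [/existsP[e /eqP et]|nt].
  by rewrite !(S _ _ _ et) in_symD.
by rewrite !(negPf (N _ _ nt)).
Qed.

Definition component (D : {set E}) (a : T) : {set E} :=
  [set x | [exists e in D, (sl e == Some a) && connect (adj D) e x]].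

Definition other_end (D : {set E}) (a : T) : T :=
  odflt a [pick b | (b != a) && (b \in slots (component D a))].

Lemma componentE (D : {set E}) a e : e \in D -> sl e = Some a ->
  component D a = [set x | connect (adj D) e x].
Proof.
move=> eD ea; apply/setP => x; rewrite !inE; apply/exists_inP/idP.
  by case=> e' _ /andP[/eqP e'a]; rewrite (sl_inj ea e'a).
by move=> ex; exists e => //; rewrite ea eqxx.
Qed.

Lemma adj_in (D : {set E}) e x : e \in D -> connect (adj D) e x -> x \in D.
Proof.
move=> eD ex; have cl : fingraph.closed (adj D) (mem D).
  apply: intro_closed; first exact: connect_adj_sym.
  by move=> u v /and3P[].
have : (e \in D) = (x \in D) := closed_connect cl ex.
by rewrite eD => <-.
Qed.

(** The path starts at a with an edge of Q and alternates between Q and P; both of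
its ends are black, so that its number of edges is even and its last edge is in
P. *)
Lemma other_endP P Q a (D := symD P Q) (b := other_end D a) :
  perfect P -> perfect Q -> a \in slots Q -> a \notin slots P ->
  [/\ b \in slots P, b \notin slots Q, b != a, other_end D b = a &
      component D b = component D a /\ slots (component D a) = [set a; b]].
Proof.
move=> pP pQ aQ aP.
have boundary x t : sl x = Some t -> bl x \notin BS by move=> xt; rewrite -sl_BS xt.
have inS (A : {set E}) e t : e \in A -> sl e = Some t -> t \in slots A.
  by move=> eA et; rewrite inE; apply/exists_inP; exists e; rewrite ?et.
have [e eQ ea] : exists2 e, e \in Q & sl e = Some a.
  by move: aQ; rewrite inE => /exists_inP[e eQ /eqP]; exists e.
have eQP : e \in Q :\: P.
  rewrite inE eQ andbT; apply: contraNN aP => eP; exact: (inS _ e).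
have eD : e \in D by rewrite /D inE eQP orbT.
have [f [fPQ fB ef ends]] := path_ends pP pQ eQP (boundary _ _ ea).
have fD : f \in D by rewrite /D inE fPQ.
have [b' fb] : exists b', sl f = Some b'.
  by move: fB; rewrite -sl_BS; case: (sl f) => // b' _; exists b'.
have fP : f \in P by move: fPQ; rewrite inE => /andP[].
have fQ : f \notin Q by move: fPQ; rewrite inE => /andP[].
have fe : f != e by apply: contraNneq fQ => ->.
have b'a : b' != a by apply: contraNneq fe => ba; rewrite ba in fb; rewrite (sl_inj fb ea).
have Ca := componentE eD ea.
have sC : slots (component D a) = [set a; b'].
  apply/setP => t; rewrite !inE; apply/exists_inP/orP.
    case=> x; rewrite Ca inE => ex /eqP xt.
    case: (ends _ ex (boundary _ _ xt)) => xE; rewrite xE in xt.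
      by left; move: xt; rewrite ea => -[->].
    by right; move: xt; rewrite fb => -[->].
  case=> /eqP->; [exists e|exists f]; rewrite ?ea ?fb // Ca inE ?connect0 //.
have other (x y : T) : x != y -> slots (component D x) = [set x; y] -> other_end D x = y.
  move=> xy sx; rewrite /other_end; case: pickP => [z /=|/(_ y)].
    by rewrite sx !inE => /andP[/negPf->] /= /eqP.
  by rewrite sx !inE eqxx orbT eq_sym xy.
have bE : b = b' by apply: other => //; rewrite eq_sym.
have Cb : component D b' = component D a.
  rewrite Ca (componentE fD fb); apply/setP => x; rewrite !inE.
  by apply/esym/same_connect => //; apply: connect_adj_sym.
rewrite bE; split=> //.
- exact: (inS _ f).
- rewrite inE; apply/exists_inP => -[x xQ /eqP xb].
  by rewrite (sl_inj xb fb) (negPf fQ) in xQ.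
- by apply: other => //; rewrite Cb sC finset.setUC.
Qed.

(** At each vertex, C contains all edges of the symmetric difference or none of them,
so the new set has there the edges of Q or those of P. *)
Lemma swap_perfect P Q (C : {set E}) : perfect P -> perfect Q -> C \subset symD P Q ->
  (forall x y, adj (symD P Q) x y -> x \in C -> y \in C) -> perfect (symD P C).
Proof.
move=> pP pQ /fintype.subsetP CD cl.
have star (S : pred E) : (forall x y, x \in symD P Q -> y \in symD P Q -> S x -> S y ->
      adj (symD P Q) x y) ->
    #|[set e in P | S e]| == 1%N -> #|[set e in Q | S e]| == 1%N ->
    #|[set e in symD P C | S e]| == 1%N.
  move=> Sadj P1 Q1; case: (boolP [exists x in C, S x]) => [/exists_inP[x xC Sx]|nC].
    move: Q1; congr (_ == _); apply: eq_card => y; rewrite [LHS]inE [RHS]inE.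
    case Sy: (S y); rewrite ?andbF // !andbT in_symD.
    case: (boolP (y \in symD P Q)) => yD.
      rewrite (cl _ _ (Sadj _ _ (CD _ xC) yD Sx Sy) xC).
      by move: yD; rewrite in_symD; case: (y \in P) (y \in Q) => [] [].
    rewrite (contraNF (CD y) yD).
    by move: yD; rewrite in_symD; case: (y \in P) (y \in Q) => [] [].
  move: P1; congr (_ == _); apply: eq_card => y; rewrite [LHS]inE [RHS]inE in_symD.
  case Sy: (S y); rewrite ?andbF // !andbT.
  suff -> : (y \in C) = false by rewrite addbF.
  by apply: contraNF nC => yC; apply/exists_inP; exists y.
case/andP: pP => /forall_inP PW /forall_inP PB.
case/andP: pQ => /forall_inP QW /forall_inP QB.
apply/andP; split; apply/forall_inP => v vS; apply: star; auto.
- by move=> x y xD yD /eqP xv /eqP yv; rewrite /adj xD yD /sameW xv yv eqxx.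
- by move=> x y xD yD /eqP xv /eqP yv; rewrite /adj xD yD /sameB xv yv eqxx vS orbT.
Qed.

Lemma component_sub (D : {set E}) a : component D a \subset D.
Proof. by apply/fintype.subsetP => x; rewrite inE => /exists_inP[e eD /andP[_ /(adj_in eD)]]. Qed.

Lemma component_closed D a x y : adj D x y -> x \in component D a -> y \in component D a.
Proof.
move=> xy; rewrite !inE => /exists_inP[e eD /andP[ea ex]].
apply/exists_inP; exists e => //; rewrite ea /=.
by apply: connect_trans ex (connect1 xy).
Qed.

Lemma swap_weight P Q (C : {set E}) : C \subset symD P Q ->
  (\prod_(e in symD P C) wt e) * (\prod_(e in symD Q C) wt e) =
  (\prod_(e in P) wt e) * (\prod_(e in Q) wt e).
Proof.
move=> /fintype.subsetP CD.
have pr (A : {set E}) : \prod_(e in A) wt e = \prod_e (if e \in A then wt e else 1).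
  by rewrite [RHS](bigID (mem A)) /= [X in _ * X]big1 ?mulr1 => [|e /negPf->//];
     apply: eq_bigr => e ->.
rewrite !pr -!big_split; apply: eq_bigr => e _ /=; rewrite !in_symD.
have := CD e; rewrite in_symD; case: (e \in C) => [/(_ isT)|_]; last by rewrite !addbF.
by case: (e \in P); case: (e \in Q) => //= _; rewrite mulrC.
Qed.

Definition noncrossing := forall (D : {set E}) e f e' f' a b c d,
  e \in D -> e' \in D ->
  sl e = Some a -> sl f = Some b -> sl e' = Some c -> sl f' = Some d ->
  connect (adj D) e f -> connect (adj D) e' f' -> ~~ connect (adj D) e e' ->
  (r a < r c < r b)%N -> (r a < r d < r b)%N.

Hypothesis nc : noncrossing.

(** The slots of D strictly between the two ends of a path are matched with each
other by the other paths. *)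
Lemma even_between P Q a (D := symD P Q) (b := other_end D a) (lo hi : T) :
  perfect P -> perfect Q -> a \in slots Q -> a \notin slots P ->
  lo = a /\ hi = b \/ lo = b /\ hi = a ->
  ~~ odd #|[set x in slots D | (r lo < r x < r hi)%N]|.
Proof.
move=> pP pQ aQ aP lohi.
have [bP bQ ba ob [Cb sC]] := other_endP pP pQ aQ aP; rewrite -/D -/b in bP bQ ba ob Cb sC.
have sD : slots D = symD (slots P) (slots Q) by apply: slots_symD.
apply: (@even_card_involution _ _ r (other_end D) r_inj) => x.
rewrite inE => /andP[xD lxh].
have xab : x \notin [set a; b].
  rewrite !inE; apply/norP; split; apply/eqP => xE;
  by move: lxh; case: lohi => -[-> ->]; rewrite xE ltnn ?andbF.
have [yx oy Cy sCx yD] : [/\ other_end D x != x, other_end D (other_end D x) = x,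
    component D (other_end D x) = component D x,
    slots (component D x) = [set x; other_end D x] & other_end D x \in slots D].
  move: (xD); rewrite sD in_symD.
  case xP: (x \in slots P) => /= xQ.
    have := @other_endP Q P x pQ pP xP xQ; rewrite symDC -/D => -[yQ yP yx oy [Cy sCy]].
    by split=> //; rewrite in_symD yQ (negPf yP).
  have := @other_endP P Q x pP pQ xQ (negbT xP); rewrite -/D => -[yQ yP yx oy [Cy sCy]].
  by split=> //; rewrite in_symD yQ (negPf yP).
split=> //; rewrite inE yD /=.
have edge_of A t : t \in slots A -> exists2 e, e \in A & sl e = Some t.
  by rewrite inE => /exists_inP[e eA /eqP et]; exists e.
have [e' e'D e'x] := edge_of _ _ xD.
have Cx := componentE e'D e'x.
have [f' f'C f'y] : exists2 f, f \in component D x & sl f = Some (other_end D x).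
  by apply: edge_of; rewrite sCx !inE eqxx orbT.
have loC : lo \in slots (component D a).
  by rewrite sC !inE; case: lohi => -[-> _]; rewrite eqxx ?orbT.
have hiC : hi \in slots (component D a).
  by rewrite sC !inE; case: lohi => -[_ ->]; rewrite eqxx ?orbT.
have [e eC elo] := edge_of _ _ loC; have [f fC fhi] := edge_of _ _ hiC.
have [e0 e0D e0a] : exists2 e, e \in D & sl e = Some a.
  by apply: edge_of; rewrite sD in_symD aQ (negPf aP).
have Ca := componentE e0D e0a.
have eD : e \in D by apply: (fintype.subsetP (component_sub D a)).
apply: (@nc D e f e' f' lo hi x _) => //.
- move: eC fC; rewrite Ca !inE => e0e e0f; apply: connect_trans e0f.
  by rewrite connect_adj_sym.
- by move: f'C; rewrite Cx inE.
- apply: contraNN xab => ee'; rewrite -sC inE; apply/exists_inP; exists e'; rewrite ?e'x //.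
  by move: eC; rewrite Ca !inE => e0e; apply: connect_trans ee'.
Qed.

(** Moving from a to b, the two counts together change by the number of elements of
K and L between a and b, which is even, and by one for a itself, which lies in K
and is below b. *)
Lemma below_parity (K L : {set T}) a b : a \in K :\: L -> b \in K :\: L ->
  (r a < r b)%N -> ~~ odd #|[set x in symD K L | (r a < r x < r b)%N]| ->
  odd (below r K b + below r L b) = ~~ odd (below r K a + below r L a).
Proof.
move=> aKL bKL ab ev; pose B (A : {set T}) := [set x in A | (r a < r x < r b)%N].
have split A : below r A b = (below r A a + (a \in A) + #|B A|)%N.
  rewrite /below -(cardsID [set x | (r x < r a)%N]) -addnA; congr addn.
    apply: eq_card => x; rewrite !inE; case: (x \in A) => //=.
    by case: (ltnP (r x) (r a)) => xa; rewrite ?andbF // (ltn_trans xa ab).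
  rewrite (cardsD1 a) !inE ltnn ab andbT; congr addn.
  apply: eq_card => x; rewrite !inE -leqNgt leq_eqVlt (inj_eq r_inj) eq_sym.
  by case: (x \in A); rewrite ?andbF //=; case: eqVneq => [->|_] //=; rewrite ltnn.
have : ~~ odd (#|B K| + #|B L|)%N.
  rewrite -card_symD; move: ev; congr (~~ odd _); apply: eq_card => x.
  rewrite [LHS]inE !in_symD [x \in B _]inE [x \in B L]inE.
  by case: (_ < _ < _)%N; rewrite ?andbF ?andbT.
move: aKL; rewrite !split !inE => /andP[/negPf-> ->].
rewrite !oddD /=; by case: (odd _) (odd _) (odd _) (odd _) => [] [] [] [].
Qed.

(** Exchanging P and Q along the path that starts at a reverses the sign of the
term. It does not change the symmetric difference, hence neither the path, so
doing it again from the other end restores the term. *)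
Theorem matching_sum_plucker : plucker_relations r matching_sum.
Proof.
move=> K L.
pose good (x : T * ({set E} * {set E})) := [&& x.1 \in K :\: L,
   perfect x.2.1 && (slots x.2.1 == K :\ x.1) & perfect x.2.2 && (slots x.2.2 == x.1 |: L)].
pose term (x : T * ({set E} * {set E})) : F :=
  (-1) ^+ (below r K x.1 + below r L x.1) *
   ((\prod_(e in x.2.1) wt e) * (\prod_(e in x.2.2) wt e)).
transitivity (\sum_(x | good x) term x).
  rewrite -(pair_big_dep (mem (K :\: L)) (fun a y => (perfect y.1 && (slots y.1 == K :\ a)) &&
     (perfect y.2 && (slots y.2 == a |: L))) (fun a y => term (a, y))) /=.
  apply: eq_bigr => a _; rewrite /matching_sum big_distrlr /= mulr_sumr.
  rewrite -(pair_big_dep (fun P => perfect P && (slots P == K :\ a))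
      (fun P Q => perfect Q && (slots Q == a |: L)) (fun P Q => term (a, (P, Q)))) /=.
  by apply: eq_bigr => P _; rewrite mulr_sumr.
pose phi (x : T * ({set E} * {set E})) :=
  let D := symD x.2.1 x.2.2 in let C := component D x.1 in
  (other_end D x.1, (symD x.2.1 C, symD x.2.2 C)).
apply: (@sum_sign_reversing _ _ _ _ phi) => -[a [P Q]] /and3P[/= aKL].
move=> /andP[pP /eqP sP] /andP[pQ /eqP sQ].
have [aK aL] : a \in K /\ a \notin L by move: aKL; rewrite inE => /andP[].
have aQ : a \in slots Q by rewrite sQ finset.setU11.
have aP : a \notin slots P by rewrite sP finset.setD11.
have [bP bQ ba ob [Cb sC]] := other_endP pP pQ aQ aP.
have ev := even_between pP pQ aQ aP.
rewrite /phi /=; set D := symD P Q in bP bQ ba ob Cb sC ev *.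
set b := other_end D a in bP bQ ba ob Cb sC ev *; set C := component D a in Cb sC *.
have CD : C \subset D by apply: component_sub.
have cl x y : adj D x y -> x \in C -> y \in C by apply: component_closed.
have bKL : b \in K :\: L.
  by move: bP bQ; rewrite sP sQ !inE negb_or => /andP[_ ->] /andP[_ ->].
have [bK bL] : b \in K /\ b \notin L by move: bKL; rewrite inE => /andP[].
split.
- rewrite /good /= bKL (swap_perfect pP pQ CD cl) (swap_perfect pQ pP) 1?symDC //=.
  rewrite !slots_symD sC sP sQ; apply/andP; split; apply/eqP/setP => x; rewrite in_symD !inE;
  [case: (eqVneq x a) => [->|xa] | case: (eqVneq x a) => [->|xa]];
  rewrite ?[a == b]eq_sym ?(negPf ba) ?(negPf aL) //=;
  by case: (eqVneq x b) => [->|]; rewrite ?bK ?(negPf bL) ?addbF ?addFb.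
- by rewrite symD2 -/D ob Cb !symDK.
- rewrite /term /= swap_weight // -mulNr; congr (_ * _).
  have sD : slots D = symD K L.
    rewrite slots_symD sP sQ; apply/setP => x; rewrite !in_symD !inE.
    by case: (eqVneq x a) => [->|//]; rewrite aK (negPf aL).
  have par : odd (below r K b + below r L b) = ~~ odd (below r K a + below r L a).
    move: ba; rewrite -(inj_eq r_inj) neq_ltn => /orP[lt|lt].
      have := below_parity bKL aKL lt; rewrite -sD => ->; first by rewrite negbK.
      by apply: ev; right.
    by apply: below_parity => //; rewrite -sD; apply: ev; left.
  rewrite -signr_odd par -[in RHS]signr_odd; case: (odd _) => /=; rewrite ?expr0 ?expr1 ?opprK //.
Qed.

End DoubleDimer.

(** * Crossing chains in a half-plane *)

Section DiscreteCrossing.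
Variable R : realFieldType.

Definition box_close (eps : R) (p q : R * R) : Prop :=
  `|p.1 - q.1| < eps /\ `|p.2 - q.2| < eps.

(** The open upper half-plane and the two quadrants of the closed lower half-plane:
a small set that meets all three of them is close to the origin. *)
Definition sector (p : R * R) : nat :=
  if 0 < p.2 then 0 else if p.1 < 0 then 1 else 2.

(** Signed crossings of the negative vertical axis. *)
Definition turn (u v : nat) : int :=
  ((u == 1%N) && (v == 2%N))%:Z - ((u == 2%N) && (v == 1%N))%:Z.

(** If one of the three sectors is avoided, the crossings along the boundary of a
square add up to zero. *)
Lemma turn_square s0 s1 s2 s3 : (s0 < 3)%N -> (s1 < 3)%N -> (s2 < 3)%N -> (s3 < 3)%N ->
  (exists2 s, (s < 3)%N & s \notin [:: s0; s1; s2; s3]) ->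
  turn s0 s1 + turn s1 s2 = turn s0 s3 + turn s3 s2.
Proof.
case: s0 => [|[|[|//]]]; case: s1 => [|[|[|//]]]; case: s2 => [|[|[|//]]];
case: s3 => [|[|[|//]]] => _ _ _ _ -[s]; rewrite !inE => s3 sn //; exfalso; lia.
Qed.

(** Summing over all squares of the grid, the contributions of the inner edges
cancel. *)
Lemma grid_boundary (H V : nat -> nat -> int) m m' :
  (forall i j, (i < m)%N -> (j < m')%N -> H i j + V i.+1 j = V i j + H i j.+1) ->
  \sum_(i < m) H i 0 + \sum_(j < m') V m j = \sum_(j < m') V 0 j + \sum_(i < m) H i m'.
Proof.
move=> sq; elim: m' sq => [|m' IH] sq; first by rewrite !big_ord0 addr0 add0r.
rewrite !big_ord_recr /= addrA IH; last by move=> i j im jm; apply: sq => //; apply: ltnW.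
rewrite -!addrA; congr (_ + _).
have {}sq i : (i < m)%N -> H i m' + V i.+1 m' = V i m' + H i m'.+1.
  by move=> im; apply: sq.
elim: m sq {IH} => [|m IH] sq; first by rewrite !big_ord0 addr0 add0r.
rewrite !big_ord_recr /= -addrA sq // addrA addrA IH //.
by move=> i im; apply: sq; apply: ltnW.
Qed.

Lemma sector_lt3 p : (sector p < 3)%N.
Proof. by rewrite /sector; case: ifP => // _; case: ifP. Qed.

(** Within the lower half-plane the crossings are the differences of sectors. *)
Lemma sum_turn m (s : nat -> nat) : (forall i, (i <= m)%N -> (0 < s i < 3)%N) ->
  \sum_(i < m) turn (s i) (s i.+1) = (s m)%:Z - (s 0)%:Z.
Proof.
elim: m => [|m IH] s12; first by rewrite big_ord0 subrr.
rewrite big_ord_recr /= IH; last by move=> i im; apply: s12; apply: leqW.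
have := s12 m (leqnSn _); have := s12 m.+1 (leqnn _).
by case: (s m) => [|[|[|//]]] //; case: (s m.+1) => [|[|[|//]]] //; rewrite /turn /=; lia.
Qed.

Lemma sector_near0 eps p0 p1 p2 : sector p0 = 0%N -> sector p1 = 1%N -> sector p2 = 2%N ->
  box_close eps p1 p0 -> box_close eps p1 p2 -> `|p1.1| < eps /\ `|p1.2| < eps.
Proof.
rewrite /sector; case: (ltrP 0 p0.2) => [h0 _|_]; last by case: ifP.
case: (ltrP 0 p1.2) => // h1; case: (ltrP p1.1 0) => // k1 _.
case: (ltrP 0 p2.2) => // h2; case: (ltrP p2.1 0) => // k2 _.
move=> [_ /ltr_normlP[c1 c2]] [/ltr_normlP[c3 c4] _].
by split; apply/ltr_normlP; split; lra.
Qed.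

Lemma box_close_pair eps p q u v : box_close eps p q ->
  u = p \/ u = q -> v = p \/ v = q -> box_close eps u v.
Proof.
move=> [c1 c2]; have e0 : 0 < eps by apply: le_lt_trans c1.
by move=> [->|->] [->|->]; rewrite /box_close ?subrr ?normr0 //; split; rewrite // distrC.
Qed.

Lemma box_closeB eps p p' q q' : box_close eps p p' -> box_close eps q q' ->
  box_close (eps *+ 2) (p - q) (p' - q').
Proof.
move=> [/ltr_normlP[a1 a2] /ltr_normlP[b1 b2]] [/ltr_normlP[c1 c2] /ltr_normlP[d1 d2]].
by rewrite mulr2n; split; apply/ltr_normlP; split => /=; lra.
Qed.

(** Follow x i - y j along the boundary of the grid. While y is at c or d, the
difference is in the closed upper half-plane and its crossings vanish, because
no step moves x from one point of the axis to another one. While x is at a or b,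
it is in the closed lower half-plane: at a it starts and ends on the left, at b
it passes from the right to the left. So the crossings along the boundary add up
to -1 although each small square contributes 0, as x i - y j stays away from the
origin. *)
Theorem discrete_crossing (x y : nat -> R * R) m m' (a b c d eps : R) :
  x 0 = (a, 0) -> x m = (b, 0) -> y 0 = (c, 0) -> y m' = (d, 0) ->
  a < c -> c < b -> b < d ->
  (forall i, (i <= m)%N -> 0 <= (x i).2) -> (forall j, (j <= m')%N -> 0 <= (y j).2) ->
  (forall i, (i < m)%N -> box_close eps (x i) (x i.+1)) ->
  (forall j, (j < m')%N -> box_close eps (y j) (y j.+1)) ->
  (forall i j, (i <= m)%N -> (j <= m')%N -> ~ box_close (eps *+ 2) (x i) (y j)) ->
  (forall i, (i < m)%N -> (x i).2 = 0 -> (x i.+1).2 = 0 -> x i = x i.+1) ->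
  False.
Proof.
move=> x0 xm y0 ym ac cb bd xpos ypos xstep ystep xy xline.
pose l i j := sector (x i - y j).
have lE i j : l i j = if 0 < (x i).2 - (y j).2 then 0%N
    else if (x i).1 - (y j).1 < 0 then 1%N else 2%N by [].
have sq i j : (i < m)%N -> (j < m')%N ->
    turn (l i j) (l i.+1 j) + turn (l i.+1 j) (l i.+1 j.+1) =
    turn (l i j) (l i j.+1) + turn (l i j.+1) (l i.+1 j.+1).
  move=> im jm; apply: turn_square; try exact: sector_lt3.
  set S := [:: _; _; _; _].
  case: (boolP (0%N \in S)) => [S0|]; last by exists 0%N.
  case: (boolP (1%N \in S)) => [S1|]; last by exists 1%N.
  case: (boolP (2%N \in S)) => [S2|]; last by exists 2%N.
  have mem s : s \in S -> exists i' j', [/\ i' = i \/ i' = i.+1, j' = j \/ j' = j.+1 & l i' j' = s].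
    rewrite !inE => /or4P[] /eqP->; [exists i, j|exists i.+1, j|exists i.+1, j.+1|exists i, j.+1];
    by split; auto.
  have [i0 [j0 [i0E j0E l0]]] := mem _ S0.
  have [i1 [j1 [i1E j1E l1]]] := mem _ S1.
  have [i2 [j2 [i2E j2E l2]]] := mem _ S2.
  have sx i' i'' : i' = i \/ i' = i.+1 -> i'' = i \/ i'' = i.+1 -> box_close eps (x i') (x i'').
    move=> E' E''; apply: (box_close_pair (xstep i im)); [case: E' => ->|case: E'' => ->]; auto.
  have sy j' j'' : j' = j \/ j' = j.+1 -> j'' = j \/ j'' = j.+1 -> box_close eps (y j') (y j'').
    move=> E' E''; apply: (box_close_pair (ystep j jm)); [case: E' => ->|case: E'' => ->]; auto.
  have c01 := box_closeB (sx _ _ i1E i0E) (sy _ _ j1E j0E).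
  have c12 := box_closeB (sx _ _ i1E i2E) (sy _ _ j1E j2E).
  exfalso; apply: (xy i1 j1).
  - by case: i1E => ->; rewrite // ltnW.
  - by case: j1E => ->; rewrite // ltnW.
  have [n1 n2] := sector_near0 l0 l1 l2 c01 c12.
  by split.
have H0 i j : (i < m)%N -> (y j).2 = 0 -> turn (l i j) (l i.+1 j) = 0.
  move=> im yj; rewrite !lE yj !subr0.
  have := xpos i (ltnW im); have := xpos i.+1 im; have := xline i im.
  case: (ltrP 0 (x i).2) => h1; first by rewrite /turn /= subrr.
  case: (ltrP 0 (x i.+1).2) => h2 E p1 p2; first by rewrite /turn andbF andbF subrr.
  rewrite E; [by rewrite /turn; case: ifP| |]; apply/eqP; rewrite eq_le ?h1 ?h2 //.
have V12 i j : (x i).2 = 0 -> (j <= m')%N -> (0 < l i j < 3)%N.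
  move=> xi jm; rewrite sector_lt3 andbT lE xi sub0r oppr_gt0 ltNge ypos //=.
  by case: ifP.
have := @grid_boundary (fun i j => turn (l i j) (l i.+1 j))
  (fun i j => turn (l i j) (l i j.+1)) m m' sq.
rewrite [X in X + _]big1 => [|i _]; last by apply: H0; rewrite ?y0.
rewrite [X in _ = _ + X]big1 => [|i _]; last by apply: H0; rewrite ?ym.
rewrite (sum_turn (s := l m)) => [|i im]; last by apply: V12; rewrite ?xm.
rewrite (sum_turn (s := l 0%N)) => [|i im]; last by apply: V12; rewrite ?x0.
rewrite !lE x0 xm y0 ym /= subrr ltxx !subr_lt0 ac (lt_trans ac) ?(lt_trans cb) //.
by rewrite bd ltNge ltW.
Qed.
End DiscreteCrossing.

(** * Chains along arcs *)

Section Chains.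
Local Open Scope classical_set_scope.
Local Open Scope ring_scope.
Variable R : realType.
Implicit Types (X : set (R * R)) (eps : R) (p q : R * R).

(** A discrete substitute for a path: chains can be concatenated without
reparametrization. *)
Definition chained X eps p q := exists m (x : nat -> R * R),
  [/\ x 0%N = p, x m = q, forall i, (i <= m)%N -> X (x i) &
      forall i, (i < m)%N -> box_close eps (x i) (x i.+1)].

Lemma chained_refl X eps p : X p -> chained X eps p p.
Proof. by move=> Xp; exists 0%N, (fun _ => p). Qed.

Lemma chained_trans X eps p q s : chained X eps p q -> chained X eps q s ->
  chained X eps p s.
Proof.
move=> [m [x [x0 xm xX xc]]] [m' [y [y0 ym yX yc]]].
exists (m + m')%N, (fun i => if (i <= m)%N then x i else y (i - m)%N); split.
- by [].
- case: leqP => mm; last by rewrite addKn.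
  have m0 : m' = 0%N by lia.
  by rewrite m0 addn0 xm -y0 -ym m0.
- by move=> i im; case: leqP => mi; [apply: xX|apply: yX; lia].
- move=> i im; case: (ltngtP i m) => mi.
  + by apply: xc.
  + by rewrite subSn; [apply: yc; lia|apply: ltnW].
  + rewrite mi subSnn xm -y0; apply: yc; lia.
Qed.

Lemma box_close_sym eps p q : box_close eps p q -> box_close eps q p.
Proof. by move=> [p1 p2]; split; rewrite distrC. Qed.

Lemma chained_sym X eps p q : chained X eps p q -> chained X eps q p.
Proof.
move=> [m [x [x0 xm xX xc]]]; exists m, (fun i => x (m - i)%N); split.
- by rewrite subn0.
- by rewrite subnn.
- by move=> i im; apply: xX; apply: leq_subr.
- move=> i im; apply: box_close_sym; have -> : (m - i)%N = (m - i.+1).+1 by lia.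
  by apply: xc; lia.
Qed.

Lemma chained_sub X X' eps p q : X `<=` X' -> chained X eps p q -> chained X' eps p q.
Proof.
by move=> XX [m [x [x0 xm xX xc]]]; exists m, x; split=> // i im; apply/XX/xX.
Qed.

Definition unit_continuous (g : R -> R * R) := forall s, 0 <= s <= 1 -> forall e, 0 < e ->
  exists2 d, 0 < d & forall t, 0 <= t <= 1 -> `|t - s| < d -> box_close e (g t) (g s).

Lemma within_unit_continuous (g : R -> R) : {within `[0, 1], continuous g} ->
  forall s, 0 <= s <= 1 -> forall e, 0 < e ->
  exists2 d, 0 < d & forall t, 0 <= t <= 1 -> `|t - s| < d -> `|g t - g s| < e.
Proof.
move=> /subspace_continuousP gc s s01 e e0.
have /gc/cvgrPdist_lt/(_ e e0) : `[0, 1]%classic s by rewrite /= in_itv.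
rewrite near_withinE => /nbhs_ballP[d /= d0 H]; exists d => // t t01 td.
rewrite distrC; apply: (H t); last by rewrite /= in_itv.
by rewrite /ball /= distrC.
Qed.

(** The supremum s of the parameters of reachable points is itself reachable, and a
neighbourhood of s is reachable from s, so s = 1. *)
Lemma curve_chained (g : R -> R * R) eps : unit_continuous g -> 0 < eps ->
  chained (g @` `[0, 1]) eps (g 0) (g 1).
Proof.
move=> gc e0; pose C := chained (g @` `[0, 1]) eps (g 0).
pose S := [set t | 0 <= t <= 1 /\ C (g t)].
have im t : 0 <= t <= 1 -> (g @` `[0, 1]) (g t) by move=> t01; exists t; rewrite //= in_itv.
have S0 : S 0 by split; [rewrite lexx ler01|apply/chained_refl/im; rewrite lexx ler01].
have S1 t : S t -> t <= 1 by case=> /andP[].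
have hS : has_sup S by split; [exists 0|exists 1 => t /S1].
pose s := sup S.
have s01 : 0 <= s <= 1.
  apply/andP; split; first exact: (ub_le_sup hS.2 S0).
  by apply: ge_sup; [exists 0|move=> t /S1].
have e20 : 0 < eps / 2 by rewrite divr_gt0.
have [d d0 near] := gc s s01 _ e20.
have near2 t t' : 0 <= t <= 1 -> 0 <= t' <= 1 -> `|t - s| < d -> `|t' - s| < d ->
    S t -> S t'.
  move=> t01 t'01 td t'd [_ Ct]; split=> //; apply: chained_trans Ct _.
  exists 1%N, (fun i => if i == 0%N then g t else g t'); split=> //.
    by case=> [|i] _; apply: im.
  case=> [|//] _ /=; have [/ltr_normlP[a1 a2] /ltr_normlP[b1 b2]] := near t t01 td.
  have [/ltr_normlP[c1 c2] /ltr_normlP[d1 d2]] := near t' t'01 t'd.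
  by split; apply/ltr_normlP; split; lra.
have [t St st] := sup_adherent d0 hS.
have ts : t <= s by apply: ub_le_sup => //; case: hS.
have td : `|t - s| < d by apply/ltr_normlP; split; rewrite -/s in st; lra.
have t01 : 0 <= t <= 1 by case: St.
case: (lerP 1 (s + d / 2)) => sd.
  have : S 1.
    apply: (near2 t 1) => //; first by rewrite ler01 lexx.
    by apply/ltr_normlP; split; move/andP: s01 => [s0 s1]; lra.
  by case.
have : S (s + d / 2).
  apply: (near2 t) => //.
    by move/andP: s01 => [s0 s1]; apply/andP; split; lra.
  by apply/ltr_normlP; split; lra.
move=> /(ub_le_sup hS.2); rewrite -/s => H; exfalso; lra.
Qed.

(** The distance of f s and g t attains a minimum on the square of parameters. *)
Lemma curves_apart (f g : R -> R * R) : unit_continuous f -> unit_continuous g ->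
  (forall s t, 0 <= s <= 1 -> 0 <= t <= 1 -> f s <> g t) ->
  exists2 eps, 0 < eps & forall s t, 0 <= s <= 1 -> 0 <= t <= 1 -> ~ box_close eps (f s) (g t).
Proof.
move=> fc gc fg.
pose A := (`[0, 1] `*` `[0, 1] : set (R * R)).
pose h (p : R * R) := `|(f p.1).1 - (g p.2).1| + `|(f p.1).2 - (g p.2).2|.
have cA : compact A by apply: compact_setX; apply: segment_compact.
have A0 : A !=set0 by exists (0, 0); split; rewrite /= in_itv /= lexx ler01.
have hc : {within A, continuous h}.
  apply/subspace_continuousP => -[s t] [/= ]; rewrite !in_itv /= => s01 t01.
  apply/cvgrPdist_lt => e e0; rewrite near_withinE.
  have e4 : 0 < e / 4 by rewrite divr_gt0.
  have [d1 d10 H1] := fc s s01 _ e4; have [d2 d20 H2] := gc t t01 _ e4.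
  apply/nbhs_ballP; exists (Num.min d1 d2); first by rewrite /= lt_min d10 d20.
  move=> [s' t'] [/= b1 b2] [/= ]; rewrite !in_itv /= => s'01 t'01.
  have /(H1 _ s'01)[F1 F2] : `|s' - s| < d1.
    by move: b1; rewrite /ball /= distrC lt_min => /andP[].
  have /(H2 _ t'01)[G1 G2] : `|t' - t| < d2.
    by move: b2; rewrite /ball /= distrC lt_min => /andP[].
  have tri (u v u' v' : R) : `|u' - u| < e / 4 -> `|v' - v| < e / 4 ->
      `| `|u - v| - `|u' - v'| | < e / 2.
    move=> hu hv; apply: le_lt_trans (ler_dist_dist _ _) _.
    have -> : u - v - (u' - v') = (v' - v) - (u' - u) by ring.
    apply: le_lt_trans (ler_normB _ _) _; lra.
  rewrite -[from_subspace A h (s, t)]/(h (s, t)) -[from_subspace A h (s', t')]/(h (s', t')).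
  rewrite /h /=; set a1 := `|(f s).1 - _|; set a2 := `|(f s).2 - _|.
  set a3 := `|(f s').1 - _|; set a4 := `|(f s').2 - _|.
  have -> : a1 + a2 - (a3 + a4) = (a1 - a3) + (a2 - a4) by ring.
  apply: le_lt_trans (ler_normD _ _) _.
  have := tri _ _ _ _ F1 G1; have := tri _ _ _ _ F2 G2; rewrite -/a1 -/a2 -/a3 -/a4; lra.
have [[s t] /set_mem[/= ]] := compact_EVT_min A0 cA hc; rewrite !in_itv /= => s01 t01 hmin.
have h0 : 0 < h (s, t).
  rewrite lt_neqAle addr_ge0 // andbT eq_sym; apply/negP; rewrite paddr_eq0 //.
  rewrite !normr_eq0 !subr_eq0 => /andP[/eqP E1 /eqP E2]; apply: (fg s t) => //.
  by move: E1 E2 => /=; case: (f s) (g t) => [? ?] [? ?] /= -> ->.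
exists (h (s, t) / 2); first by rewrite divr_gt0.
move=> s' t' s'01 t'01 [c1 c2].
have : h (s, t) <= h (s', t').
  by apply: hmin; rewrite inE; split; rewrite /= in_itv.
rewrite leNgt => /negP; apply; rewrite {1}/h /=; lra.
Qed.

End Chains.

Section Trig.
Variable R : realType.

Lemma cos_lt1 (x : R) : 0 < x < 2 * pi -> cos x < 1.
Proof.
move=> /andP[x0 x2]; have -> : x = x / 2 + x / 2 by lra.
have s0 : 0 < sin (x / 2) by apply: sin_gt0_pi; rewrite ?in_itv /=; lra.
have := cos2Dsin2 (x / 2); rewrite cosD; nra.
Qed.

End Trig.

(** * Stereographic projection *)

Section Chart.
Local Open Scope classical_set_scope.
Local Open Scope ring_scope.
Variable R : realType.
Variables (theta sigma tau : R).
Hypotheses (sigma2 : sigma * sigma = 1) (tau2 : tau * tau = 1).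

Definition pole_dot (p : 'rV[R]_3) := p 0 0 * cos theta + p 0 1 * sin theta.

(** Stereographic projection from the equatorial point of angle theta, which sends
the equator to the first axis; the signs sigma and tau allow for reflections. *)
Definition chart (p : 'rV[R]_3) : R * R :=
  (sigma * (p 0 1 * cos theta - p 0 0 * sin theta) / (1 - pole_dot p),
   tau * p 0 2 / (1 - pole_dot p)).

Lemma pole_dot_lt1 p : sphere p -> p 0 2 != 0 -> pole_dot p < 1.
Proof.
rewrite /sphere /pole_dot /= => sp h0; have cs := cos2Dsin2 theta.
have : 0 < p 0 2 ^+ 2 by rewrite exprn_even_gt0.
set x := p 0 0 in sp *; set y := p 0 1 in sp *; set z := p 0 2 in sp *.
set c := cos _ in cs *; set s := sin _ in cs *.
move=> z2; rewrite ltNge; apply/negP => w1.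
have : (x * c + y * s) ^+ 2 + (y * c - x * s) ^+ 2 = x ^+ 2 + y ^+ 2.
  by rewrite -[RHS]mulr1 -cs; ring.
have := sqr_ge0 (y * c - x * s); nra.
Qed.

(** In terms of the image (u, v) and of D = 1 - pole_dot p, the equation of the
sphere reads D (u^2 + v^2 + 1) = 2. It determines D, and then the point. *)
Lemma chart_inj p p' : sphere p -> sphere p' -> pole_dot p < 1 -> pole_dot p' < 1 ->
  chart p = chart p' -> p = p'.
Proof.
rewrite /sphere /chart /= => sp sp' w1 w1' [] E1 E2; have cs := cos2Dsin2 theta.
pose A (p : 'rV[R]_3) := p 0 1 * cos theta - p 0 0 * sin theta.
have key q u v : sphere q -> pole_dot q < 1 ->
   sigma * A q / (1 - pole_dot q) = u -> tau * q 0 2 / (1 - pole_dot q) = v ->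
   [/\ (1 - pole_dot q) * (u ^+ 2 + v ^+ 2 + 1) = 2, A q = sigma * u * (1 - pole_dot q)
     & q 0 2 = tau * v * (1 - pole_dot q)].
  rewrite /sphere /= => sq wq uE vE.
  have D0 : 1 - pole_dot q != 0 by rewrite gt_eqF // subr_gt0.
  have AE : A q = sigma * u * (1 - pole_dot q).
    by rewrite -uE -[RHS]mulrA divfK // mulrA sigma2 mul1r.
  have hE : q 0 2 = tau * v * (1 - pole_dot q).
    by rewrite -vE -[RHS]mulrA divfK // mulrA tau2 mul1r.
  split=> //; apply: (mulfI D0).
  have A2 : A q ^+ 2 = u ^+ 2 * (1 - pole_dot q) ^+ 2.
    by rewrite AE !exprMn [sigma ^+ 2]sigma2 mul1r.
  have h2 : q 0 2 ^+ 2 = v ^+ 2 * (1 - pole_dot q) ^+ 2.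
    by rewrite hE !exprMn [tau ^+ 2]tau2 mul1r.
  have : A q ^+ 2 + pole_dot q ^+ 2 + q 0 2 ^+ 2 = 1.
    rewrite -sq -[q 0 0 ^+ 2 + _]mulr1 -cs /A /pole_dot; ring.
  rewrite A2 h2 => H.
  have -> : (1 - pole_dot q) * ((1 - pole_dot q) * (u ^+ 2 + v ^+ 2 + 1)) =
    (u ^+ 2 * (1 - pole_dot q) ^+ 2 + pole_dot q ^+ 2 + v ^+ 2 * (1 - pole_dot q) ^+ 2)
     + (1 - 2 * pole_dot q) by ring.
  by rewrite H; ring.
have [D1 A1 h1] := key p _ _ sp w1 E1 E2.
have [D2 A2 h2] := key p' _ _ sp' w1' erefl erefl.
set u := sigma * A p' / (1 - pole_dot p') in D1 A1 h1 D2 A2 h2.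
set v := tau * p' 0 2 / (1 - pole_dot p') in D1 A1 h1 D2 A2 h2.
have DD : 1 - pole_dot p = 1 - pole_dot p'.
  have n0 : u ^+ 2 + v ^+ 2 + 1 != 0.
    by rewrite gt_eqF // ltr_wpDl // addr_ge0 // sqr_ge0.
  by apply: (mulIf n0); rewrite D1 D2.
have ww : pole_dot p = pole_dot p' by lra.
have AA : A p = A p' by rewrite A1 A2 DD.
have hh : p 0 2 = p' 0 2 by rewrite h1 h2 DD.
have x0 (q : 'rV[R]_3) : q 0 0 = pole_dot q * cos theta - A q * sin theta.
  by rewrite /A /pole_dot -[LHS]mulr1 -cs; ring.
have x1 (q : 'rV[R]_3) : q 0 1 = pole_dot q * sin theta + A q * cos theta.
  by rewrite /A /pole_dot -[LHS]mulr1 -cs; ring.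
apply/rowP => j; case: j => -[|[|[|//]]] jlt.
- have -> : Ordinal jlt = 0 by apply: val_inj.
  by rewrite x0 [RHS]x0 ww AA.
- have -> : Ordinal jlt = 1 by apply: val_inj.
  by rewrite x1 [RHS]x1 ww AA.
- by have -> : Ordinal jlt = 2 by apply: val_inj.
Qed.

Lemma pole_dot_equator phi : pole_dot (equator_point phi) = cos (phi - theta).
Proof. by rewrite /pole_dot !mxE /= cosB. Qed.

Lemma chart_equator phi : chart (equator_point phi) =
  (sigma * (sin (phi - theta) / (1 - cos (phi - theta))), 0).
Proof.
by rewrite /chart pole_dot_equator !mxE /= mulr0 mul0r sinB mulrA [sin phi * _]mulrC
  [cos phi * _]mulrC [cos theta * _]mulrC [sin theta * _]mulrC.
Qed.

Lemma chart_continuous (c : R -> 'rV[R]_3) : {within `[0, 1], continuous c} ->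
  (forall t, 0 <= t <= 1 -> pole_dot (c t) < 1) -> unit_continuous (chart \o c).
Proof.
move=> /subspace_continuousP cc w1.
have coord j : {within `[0, 1], continuous (fun t => c t 0 j)}.
  apply/subspace_continuousP => s s01.
  apply: (@cvg_comp _ _ _ c (fun M : 'rV[R]_3 => M 0 j)); first exact: cc.
  exact: coord_continuous.
have lin (a b : R) i j : {within `[0, 1], continuous (fun t => c t 0 i * a + c t 0 j * b)}.
  move=> s; apply: cvgD; (apply: cvgM; [exact: coord|exact: cvg_cst]).
have dot_c : {within `[0, 1], continuous (fun t => pole_dot (c t))} by apply: lin.
have inv_c : {within `[0, 1], continuous (fun t => (1 - pole_dot (c t))^-1)}.
  apply/subspace_continuousP => s s01; move/subspace_continuousP: dot_c => /(_ s s01) dc.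
  apply: cvgV; last by apply: cvgB => //; apply: cvg_cst.
  rewrite subr_eq0 gt_eqF // w1 //; by move: s01; rewrite /= in_itv.
have u_c : {within `[0, 1], continuous (fun t => (chart (c t)).1)}.
  move=> s; apply: cvgM; last exact: inv_c.
  apply: cvgM; first exact: cvg_cst.
  apply: cvgB; (apply: cvgM; [exact: coord|exact: cvg_cst]).
have v_c : {within `[0, 1], continuous (fun t => (chart (c t)).2)}.
  move=> s; apply: cvgM; last exact: inv_c.
  apply: cvgM; [exact: cvg_cst|exact: coord].
move=> s s01 e e0.
have [d1 d10 H1] := within_unit_continuous u_c s01 e0.
have [d2 d20 H2] := within_unit_continuous v_c s01 e0.
exists (Num.min d1 d2); first by rewrite lt_min d10 d20.
move=> t t01; rewrite lt_min => /andP[l1 l2].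
by split; [apply: H1|apply: H2].
Qed.

End Chart.

(** Both sides are cotangents of half angles. *)
Lemma cot_half_decreasing (R : realType) (x y : R) : 0 < x -> x < y -> y < 2 * pi ->
  sin y / (1 - cos y) < sin x / (1 - cos x).
Proof.
have half (z : R) : 0 < z -> z < 2 * pi ->
    0 < sin (z / 2) /\ sin z / (1 - cos z) = cos (z / 2) / sin (z / 2).
  move=> z0 z2; have s0 : 0 < sin (z / 2) by apply: sin_gt0_pi; rewrite ?in_itv /=; lra.
  split=> //; have zE : z = z / 2 + z / 2 by lra.
  rewrite {1 2}zE sinD cosD.
  have -> : 1 - (cos (z / 2) * cos (z / 2) - sin (z / 2) * sin (z / 2)) =
     2 * (sin (z / 2) * sin (z / 2)) by rewrite -{1}(cos2Dsin2 (z / 2)); ring.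
  have s1 : sin (z / 2) != 0 by rewrite gt_eqF.
  by field.
move=> x0 xy y2; have [sx ->] := half x x0 (lt_trans xy y2).
have [sy ->] := half y (lt_trans x0 xy) y2.
rewrite ltr_pdivrMr // mulrAC ltr_pdivlMr //.
have : 0 < sin (y / 2 - x / 2) by apply: sin_gt0_pi; rewrite ?in_itv /=; lra.
rewrite sinB; lra.
Qed.

Lemma finite_common_bound (R : realType) (I : finType) (Q : I -> R -> Prop) :
  (forall i e e', Q i e -> 0 < e' -> e' <= e -> Q i e') ->
  (forall i, exists2 e, 0 < e & Q i e) -> exists2 e, 0 < e & forall i, Q i e.
Proof.
move=> mono ex.
pose f i := s2val (cid2 (ex i)).
have fE i : 0 < f i /\ Q i (f i) by rewrite /f; case: cid2.
have e0 : 0 < \big[Num.min/1]_i f i.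
  by elim/big_ind: _ => // [a b a0 b0|i _]; [rewrite lt_min a0 b0|case: (fE i)].
exists (\big[Num.min/1]_i f i) => // i; have [_ Qi] := fE i.
by apply: mono Qi e0 _; apply: bigmin_le_cond.
Qed.

(** * Planarity of the hemispheres *)

Section Network.
Local Open Scope classical_set_scope.
Local Open Scope ring_scope.
Variables (R : realType) (n : nat) (N : spherical_network R n).
Hypothesis bdry_black : forall i : 'I_n, black (bdry N i).

Let shares_vertex (D : {set edge N}) := adj (@wend _ _ N) (@bend _ _ N) (interior_black N) D.

Lemma bdry_inj : injective (bdry N).
Proof.
move=> i j ij; have [th [pE lt2 mono]] := bdry_in_order N.
have E : equator_point (th i) = equator_point (th j) by rewrite -!pE ij.
have c1 : cos (th i - th j) = 1.
  have := congr1 (fun M : 'rV_3 => M 0 0) E; have := congr1 (fun M : 'rV_3 => M 0 1) E.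
  by rewrite !mxE /= cosB => -> ->; have := cos2Dsin2 (th j); nra.
have le a b : cos (th a - th b) = 1 -> th b < th a -> False.
  move=> cab ba; have := @cos_lt1 _ (th a - th b); rewrite cab ltxx => H.
  suff : false by []. apply: H; have := lt2 a b; rewrite ltr_norml => /andP[_].
  by rewrite subr_gt0 ba => ->.
case: (ltgtP (th i) (th j)) => tij.
- by case: (le j i) => //; rewrite -opprB cosN.
- by case: (le i j).
- apply/val_inj/eqP; case: (ltngtP i j) => // lij; case: mono => /(_ _ _ lij);
  by rewrite tij ltxx.
Qed.

Lemma bdry_not_white i (e : edge N) : wend e <> bdry N i.
Proof. by move=> ei; have := wend_white e; rewrite ei bdry_black. Qed.

Lemma wend_interior (e : edge N) : wend e \in interior_white N.
Proof.
rewrite inE wend_white; apply/negP => /codomP[i ei]; exact: (bdry_not_white ei).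
Qed.

Lemma bend_interior (e : edge N) :
  (bend e \in interior_black N) = (bend e \notin codom (bdry N)).
Proof. by rewrite inE bend_black. Qed.

Lemma network_point_equator p : @sphere R p -> p 0 2 = 0 ->
  (range (@pos _ _ N) `|` \bigcup_(e : edge N) (curve e @` `[0, 1])) p ->
  exists i, p = pos (bdry N i).
Proof.
move=> sp p2 Np.
have : ((range (@pos _ _ N) `|` \bigcup_(e : edge N) (curve e @` `[0, 1])) `&` @equator R) p.
  by split.
by rewrite network_equator => -[i _ <-]; exists i.
Qed.

Lemma curve_equator (e : edge N) t : 0 <= t <= 1 -> curve e t 0 2 = 0 ->
  exists i, curve e t = pos (bdry N i).
Proof.
move=> t01 c2; have im : (curve e @` `[0, 1]) (curve e t) by exists t; rewrite //= in_itv.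
apply: network_point_equator => //; first exact: (curve_sphere im).
by right; exists e.
Qed.

Lemma vertex_equator (v : vertex N) : pos v 0 2 = 0 -> v \in codom (bdry N).
Proof.
move=> v2; have [|i vi] := network_point_equator (pos_sphere v) v2; first by left; exists v.
by rewrite (pos_inj vi) codom_f.
Qed.

(** The midpoint of an arc that lies in both hemispheres would be a point of the
network on the equator, hence a vertex. *)
Lemma upper_edgeE (e : edge N) : upper_edge e = ~~ lower_edge e.
Proof.
have hz (t : R) : 0 <= t <= 1 -> (curve e @` `[0, 1]) (curve e t).
  by move=> t01; exists t; rewrite //= in_itv.
have h01 : 0 <= (2^-1 : R) <= 1 by lra.
apply/idP/idP => [/asboolP up|/asboolP low].
  apply/negP => /asboolP low; have [_ /= u] := up _ (hz _ h01).
  have [_ /= l] := low _ (hz _ h01).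
  have [i ei] := curve_equator h01 (le_anti (introT andP (conj l u))).
  by apply: (curve_vertex _ ei); rewrite in_itv /=; lra.
by apply/asboolP; case: (edge_hemisphere e).
Qed.

Lemma curve_height (e : edge N) t : 0 <= t <= 1 ->
  0 <= (if lower_edge e then -1 else 1) * curve e t 0 2.
Proof.
move=> t01; have im : (curve e @` `[0, 1]) (curve e t) by exists t; rewrite //= in_itv.
case: ifP => [/asboolP low|/negbT]; first by have [_ /= ?] := low _ im; lra.
by rewrite -upper_edgeE => /asboolP up; have [_ /= ?] := up _ im; lra.
Qed.

Lemma bdry_edge_unique (e e' : edge N) i : bend e = bdry N i -> bend e' = bdry N i ->
  lower_edge e = lower_edge e' -> e = e'.
Proof.
move=> ei e'i ee'.
have mem (P : pred (edge N)) :
    #|[set e | ((bend e == bdry N i) || (wend e == bdry N i)) && P e]%SET| = 1%N ->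
    P e -> P e' -> e = e'.
  move=> /eqP/cards1P[x xE] Pe Pe'.
  have : e \in [set x]%SET by rewrite -xE inE ei eqxx Pe.
  have : e' \in [set x]%SET by rewrite -xE inE e'i eqxx Pe'.
  by rewrite !inE => /eqP-> /eqP->.
case le: (lower_edge e) ee' => /esym le'.
  exact: (mem _ (bdry_lower_degree N i) le le').
by apply: (mem _ (bdry_upper_degree N i)); rewrite -[`[< _ >]]/(upper_edge _) upper_edgeE ?le ?le'.
Qed.

Lemma curve_endpoints (e : edge N) v : v = bend e \/ v = wend e ->
  exists2 t, 0 <= t <= 1 & curve e t = pos v.
Proof.
case=> ->; first by exists 0; rewrite ?curve0 // lexx ler01.
by exists 1; rewrite ?curve1 // lexx ler01.
Qed.

(** The height of the vertex is not zero, and its sign decides in which hemisphere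
an edge with this end lies. *)
Lemma shared_vertex_hemisphere (e e' : edge N) v : v \notin codom (bdry N) ->
  v = bend e \/ v = wend e -> v = bend e' \/ v = wend e' -> lower_edge e = lower_edge e'.
Proof.
move=> vi ve ve'; have [t t01 te] := curve_endpoints ve.
have [t' t'01 te'] := curve_endpoints ve'.
have := curve_height e t01; have := curve_height e' t'01; rewrite te te'.
have : pos v 0 2 != 0 by apply: contraNneq vi => /vertex_equator.
case: ifP; case: ifP => // _ _ v0 h h'; exfalso; move/eqP: v0; apply; lra.
Qed.

Lemma adj_hemisphere D e e' : shares_vertex D e e' -> lower_edge e = lower_edge e'.
Proof.
move=> /and3P[_ _ /orP[/eqP ee'|/andP[eB /eqP ee']]].
  apply: (@shared_vertex_hemisphere _ _ (wend e)); rewrite ?ee'; auto.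
  by have := wend_interior e'; rewrite inE => /andP[].
apply: (@shared_vertex_hemisphere _ _ (bend e)); rewrite ?ee'; auto.
by rewrite -bend_interior -ee'.
Qed.

Lemma connect_hemisphere D e e' : connect (shares_vertex D) e e' -> lower_edge e = lower_edge e'.
Proof.
move=> ee'; have cl : fingraph.closed (shares_vertex D) [pred x | lower_edge x == lower_edge e].
  by move=> x y xy; rewrite !inE (adj_hemisphere xy).
by have := closed_connect cl ee'; rewrite !inE eqxx => /esym/eqP.
Qed.

Lemma curves_meet (f g : edge N) s t : f != g -> 0 <= s <= 1 -> 0 <= t <= 1 ->
  curve f s = curve g t -> bend f = bend g \/ wend f = wend g.
Proof.
move=> fg s01 t01 E.
have ends (e : edge N) x : 0 <= x <= 1 ->
    (x \in `]0, 1[) \/ (exists2 v, v = bend e \/ v = wend e & curve e x = pos v).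
  move=> /andP[x0 x1]; case: (eqVneq x 0) => [->|nx0].
    by right; exists (bend e); [left|rewrite curve0].
  case: (eqVneq x 1) => [->|nx1]; first by right; exists (wend e); [right|rewrite curve1].
  by left; rewrite in_itv /= !lt_neqAle x0 x1 nx1 eq_sym nx0.
have bw (e e' : edge N) : bend e <> wend e'.
  by move=> ee'; have := wend_white e'; rewrite -ee' bend_black.
case: (ends f s s01) => [si|[v vf fv]]; case: (ends g t t01) => [ti|[w wg gw]].
- by case: (curve_disjoint fg si ti E).
- by have := @curve_vertex _ _ N f w s si; rewrite E.
- by have := @curve_vertex _ _ N g v t ti; rewrite -E.
- have vw : v = w by apply: (@pos_inj _ _ N); rewrite -fv -gw.
  subst w; case: vf wg => -> [] ee; [by left|by case: (bw _ _ ee)| |by right].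
  by case: (bw _ _ (esym ee)).
Qed.

(** The pole is opposite to the middle of the arc spanned by the first and the last
vertex. Measured from the pole, the angles of all vertices lie strictly between
0 and 2 pi, where the projection is monotone; sigma accounts for the direction
of travel. *)
Lemma equator_coordinate : (0 < n)%N -> exists theta sigma : R, [/\ sigma * sigma = 1,
  forall i, pole_dot theta (pos (bdry N i)) < 1 &
  exists u : 'I_n -> R, (forall i j : 'I_n, (i < j)%N -> u i < u j) /\
    forall tau i, chart theta sigma tau (pos (bdry N i)) = (u i, 0)].
Proof.
move=> n0; have [th [pE lt2 mono]] := bdry_in_order N.
have nl : (n.-1 < n)%N by rewrite prednK.
pose a := Ordinal n0; pose z := Ordinal nl.
pose theta := (th a + th z) / 2 - pi.
have rng i : 0 < th i - theta < 2 * pi.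
  have /ltr_normlP[A1 A2] := lt2 a z.
  have ai : i = a \/ (a < i)%N.
    by case: (posnP i) => [i0|]; [left; apply: val_inj|right].
  have iz : i = z \/ (i < z)%N.
    have : (i <= n.-1)%N by rewrite -ltnS prednK.
    by rewrite leq_eqVlt => /orP[/eqP iz|]; [left; apply: val_inj|right].
  rewrite /theta; case: mono => mono.
    have h1 : th a <= th i by case: ai => [->//|/mono/ltW].
    have h2 : th i <= th z by case: iz => [->//|/mono/ltW].
    by apply/andP; split; lra.
  have h1 : th i <= th a by case: ai => [->//|/mono/ltW].
  have h2 : th z <= th i by case: iz => [->//|/mono/ltW].
  by apply/andP; split; lra.
pose f i := sin (th i - theta) / (1 - cos (th i - theta)).
have decr i j : th i < th j -> f j < f i.
  move=> ij; have /andP[? ?] := rng i; have /andP[? ?] := rng j.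
  by apply: cot_half_decreasing => //; lra.
have pd i : pole_dot theta (pos (bdry N i)) < 1.
  by rewrite pE pole_dot_equator cos_lt1.
case: mono => mono.
  exists theta, (-1); split; [by rewrite mulrNN mulr1|exact: pd|].
  exists (fun i => -1 * f i); split => [i j ij|tau i]; last by rewrite pE chart_equator.
  by rewrite !mulN1r ltrN2; apply/decr/mono.
exists theta, 1; split; [by rewrite mulr1|exact: pd|].
exists (fun i => 1 * f i); split => [i j ij|tau i]; last by rewrite pE chart_equator.
by rewrite !mul1r; apply/decr/mono.
Qed.

Section DisjointComponents.
Variables (D : {set edge N}) (e1 e2 e3 e4 : edge N) (i1 i2 i3 i4 : 'I_n).
Hypotheses (e1D : e1 \in D) (e2D : e2 \in D).
Hypotheses (c13 : connect (shares_vertex D) e1 e3) (c24 : connect (shares_vertex D) e2 e4).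
Hypothesis n12 : ~~ connect (shares_vertex D) e1 e2.
Hypotheses (b1 : bend e1 = bdry N i1) (b2 : bend e2 = bdry N i2).
Hypotheses (b3 : bend e3 = bdry N i3) (b4 : bend e4 = bdry N i4).
Hypotheses (i12 : (i1 < i2)%N) (i23 : (i2 < i3)%N) (i34 : (i3 < i4)%N).
Hypothesis h12 : lower_edge e1 = lower_edge e2.

(** Two arcs meet only at a common end. If it is an interior vertex, then the edges
lie in the same component; if it is an equatorial vertex, then they are the same
edge, since they lie in the same hemisphere. *)
Lemma components_disjoint f g s t :
  connect (shares_vertex D) e1 f -> connect (shares_vertex D) e2 g ->
  0 <= s <= 1 -> 0 <= t <= 1 -> curve f s <> curve g t.
Proof.
move=> c1f c2g s01 t01 E.
have csym : connect_sym (shares_vertex D) by apply: connect_adj_sym.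
have fg : f != g.
  by apply: contraNneq n12 => fg; rewrite fg in c1f; rewrite (connect_trans c1f) // csym.
have fD : f \in D := adj_in e1D c1f.
have gD : g \in D := adj_in e2D c2g.
have nadj : ~~ shares_vertex D f g.
  apply: contraNN n12 => /connect1 cfg.
  by rewrite (connect_trans c1f) // (connect_trans cfg) // csym.
have hfg : lower_edge f = lower_edge g.
  by rewrite -(connect_hemisphere c1f) -(connect_hemisphere c2g).
case: (curves_meet fg s01 t01 E) => ee; last first.
  by move: nadj; rewrite /shares_vertex /adj fD gD /sameW ee eqxx.
case: (boolP (bend f \in interior_black N)) => fB.
  by move: nadj; rewrite /shares_vertex /adj fD gD /sameB fB ee eqxx orbT.
move: fB; rewrite bend_interior negbK => /codomP[i fi].
have gi : bend g = bdry N i by rewrite -ee.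
by move/eqP: fg; apply; apply: bdry_edge_unique fi gi hfg.
Qed.

(** The projected components contain chains with arbitrarily small steps between
their ends on the axis, which contradicts [discrete_crossing]. *)
Lemma no_crossing : False.
Proof.
have n0 : (0 < n)%N by apply: leq_trans (ltn_ord i1).
have [theta [sigma [sigma2 pd [u [umono uE]]]]] := equator_coordinate n0.
pose h := lower_edge e1; pose tau : R := if h then -1 else 1.
have tau2 : tau * tau = 1 by rewrite /tau; case: (h); rewrite ?mulrNN mulr1.
pose phi (f : edge N) := chart theta sigma tau \o curve f.
have sph (f : edge N) t : 0 <= t <= 1 -> sphere (curve f t).
  by move=> t01; apply: (curve_sphere (e := f)); exists t; rewrite //= in_itv.
have w1 (f : edge N) t : 0 <= t <= 1 -> pole_dot theta (curve f t) < 1.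
  move=> t01; case: (eqVneq (curve f t 0 2) 0) => [/(curve_equator t01)[i ->]|]; first exact: pd.
  by apply: pole_dot_lt1; apply: sph.
have phic (f : edge N) : unit_continuous (phi f).
  by apply: chart_continuous; [apply: curve_continuous|apply: w1].
have pos2 (f : edge N) t : lower_edge f = h -> 0 <= t <= 1 -> 0 <= (phi f t).2.
  move=> fh t01; rewrite /phi /= divr_ge0 //; last by rewrite subr_ge0 ltW // w1.
  by have := curve_height f t01; rewrite fh.
have line (f : edge N) t : 0 <= t <= 1 -> (phi f t).2 = 0 -> exists i, phi f t = (u i, 0).
  move=> t01 /eqP; rewrite /phi /= !mulf_eq0 invr_eq0 subr_eq0 => /orP[/orP[|]|].
  - by rewrite /tau; case: (h); rewrite ?oppr_eq0 oner_eq0.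
  - by move/eqP/(curve_equator t01) => [i ->]; exists i; apply: uE.
  - by rewrite gt_eqF // w1.
have [eps0 eps00 gap] : exists2 e, 0 < e &
    forall ij : 'I_n * 'I_n, ij.1 != ij.2 -> e <= `|u ij.1 - u ij.2|.
  apply: (@finite_common_bound _ _ (fun ij e => ij.1 != ij.2 -> e <= `|u ij.1 - u ij.2|)).
    by move=> ij e e' H e'0 e'e ne; apply: le_trans e'e (H ne).
  move=> [i j] /=; case: (eqVneq i j) => [_|ij]; first by exists 1.
  exists `|u i - u j| => //; rewrite normr_gt0 subr_eq0; apply: contraNneq ij => uij.
  by apply/eqP/val_inj; case: (ltngtP i j) => // /umono; rewrite uij ltxx.
pose apart (fg : edge N * edge N) (e : R) :=
  connect (shares_vertex D) e1 fg.1 -> connect (shares_vertex D) e2 fg.2 ->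
  forall s t, 0 <= s <= 1 -> 0 <= t <= 1 -> ~ box_close e (phi fg.1 s) (phi fg.2 t).
have [eps1 eps10 ap] : exists2 e, 0 < e & forall fg, apart fg e.
  apply: finite_common_bound => [fg e e' H e'0 e'e c1 c2 s t s01 t01 [x1 x2]|[f g]].
    by apply: (H c1 c2 s t s01 t01); split; apply: lt_le_trans e'e.
  case: (boolP (connect (shares_vertex D) e1 f)) => c1; last first.
    by exists 1 => // c1'; rewrite c1' in c1.
  case: (boolP (connect (shares_vertex D) e2 g)) => c2; last first.
    by exists 1 => // _ c2'; rewrite c2' in c2.
  have [|e e0 H] := curves_apart (phic f) (phic g).
    move=> s t s01 t01 E; apply: (components_disjoint c1 c2 s01 t01).
    exact: (chart_inj sigma2 tau2 (sph _ _ s01) (sph _ _ t01) (w1 _ _ s01) (w1 _ _ t01) E).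
  by exists e => // _ _.
(* eps0 rules out steps between different vertices on the axis, and eps1 keeps the
   two components apart *)
pose eps := Num.min eps0 (eps1 / 2).
have eps_gt0 : 0 < eps by rewrite lt_min eps00 divr_gt0.
pose X e := [set p | exists2 f, connect (shares_vertex D) e f & (phi f @` `[0, 1]) p].
have chain e f : connect (shares_vertex D) e f -> chained (X e) eps (phi e 0) (phi f 0).
  have sub g : connect (shares_vertex D) e g -> phi g @` `[0, 1] `<=` X e.
    by move=> eg p gp; exists g.
  have ch g : connect (shares_vertex D) e g -> chained (X e) eps (phi g 0) (phi g 1).
    by move=> eg; apply: chained_sub (sub g eg) _; apply: curve_chained.
  case/connectP => s; elim/last_ind: s f => [|s f' IH] f.
    move=> _ /= ->; apply: chained_refl; apply: (sub e) => //.
    by exists 0; rewrite //= in_itv /= lexx ler01.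
  rewrite rcons_path last_rcons => /andP[ps lf] ->.
  have cl : connect (shares_vertex D) e (last e s) by apply/connectP; exists s.
  have cf' : connect (shares_vertex D) e f' by apply: connect_trans cl (connect1 lf).
  apply: chained_trans (IH _ ps erefl) _.
  move: (lf) => /and3P[_ _ /orP[/eqP ww|/andP[_ /eqP bb]]].
    apply: chained_trans (ch _ cl) _; apply: chained_sym.
    have -> : phi (last e s) 1 = phi f' 1 by rewrite /phi /= !curve1 ww.
    exact: ch.
  have -> : phi (last e s) 0 = phi f' 0 by rewrite /phi /= !curve0 bb.
  apply: chained_refl; apply: (sub f' cf').
  by exists 0; rewrite //= in_itv /= lexx ler01.
have [m [x [x0 xm xX xc]]] := chain _ _ c13.
have [m' [y [y0 ym yX yc]]] := chain _ _ c24.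
have start (e : edge N) i : bend e = bdry N i -> phi e 0 = (u i, 0).
  by move=> ei; rewrite /phi /= curve0 ei uE.
have Xpos e p : lower_edge e = h -> X e p -> 0 <= p.2.
  move=> eh [f ef [t]]; rewrite /= in_itv /= => t01 <-; apply: pos2 => //.
  by rewrite -(connect_hemisphere ef).
have Xline e p : X e p -> p.2 = 0 -> exists i, p = (u i, 0).
  by move=> [f ef [t]]; rewrite /= in_itv /= => t01 <-; apply: line.
rewrite (start _ _ b1) in x0; rewrite (start _ _ b3) in xm.
rewrite (start _ _ b2) in y0; rewrite (start _ _ b4) in ym.
apply: (discrete_crossing x0 xm y0 ym (umono _ _ i12) (umono _ _ i23) (umono _ _ i34) _ _ xc yc).
- by move=> i im; apply: (@Xpos e1) => //; apply: xX.
- by move=> j jm; apply: (@Xpos e2) => //; apply: yX.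
- move=> i j im jm [d1 d2].
  have [f cf [s]] := xX i im; rewrite /= in_itv /= => s01 fs.
  have [g cg [t]] := yX j jm; rewrite /= in_itv /= => t01 gt.
  apply: (ap (f, g) cf cg s t s01 t01); rewrite /= fs gt.
  have e21 : eps *+ 2 <= eps1.
    have half : eps <= eps1 / 2 by rewrite ge_min lexx orbT.
    by rewrite mulr2n [leRHS]splitr lerD.
  by split; [apply: lt_le_trans d1 e21|apply: lt_le_trans d2 e21].
- move=> i im x2 x2'; have [d1 _] := xc i im.
  have [j xj] := Xline _ _ (xX i (ltnW im)) x2.
  have [j' xj'] := Xline _ _ (xX i.+1 im) x2'.
  rewrite xj xj'; congr (u _, 0); apply/eqP/negPn/negP => jj'.
  have := gap (j, j') jj'; rewrite leNgt => /negP; apply => /=.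
  move: d1; rewrite xj xj' /= => /lt_le_trans; apply.
  by rewrite ge_min lexx.
Qed.

End DisjointComponents.
End Network.

(** * Matchings by slots *)

Section NetworkSlots.
Variables (R : realType) (n : nat) (N : spherical_network R n).
Hypothesis bdry_black : forall i : 'I_n, black (bdry N i).

Definition edge_slot (e : edge N) : option (slot n) :=
  omap (mkslot (lower_edge e)) [pick i | bend e == bdry N i].

Lemma edge_slotP e s :
  edge_slot e = Some s <-> exists2 i, bend e = bdry N i & s = mkslot (lower_edge e) i.
Proof.
rewrite /edge_slot; case: pickP => [i /eqP ei|ne] /=; split.
- by case=> <-; exists i.
- by case=> j; rewrite ei => /bdry_inj -> ->.
- by [].
- by case=> j ej; have := ne j; rewrite ej eqxx.
Qed.

Lemma edge_slot_None e : (edge_slot e == None) = (bend e \in interior_black N).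
Proof.
rewrite bend_interior /edge_slot; case: pickP => [i /eqP ->|ne] /=.
  by rewrite codom_f.
by apply/esym/negP => /codomP[i ei]; have := ne i; rewrite ei eqxx.
Qed.

Lemma edge_slot_inj e e' s : edge_slot e = Some s -> edge_slot e' = Some s -> e = e'.
Proof.
move=> /edge_slotP[i ei ->] /edge_slotP[j ej].
case le: (lower_edge e); case le': (lower_edge e') => //= -[ij];
by rewrite ij in ei; apply: bdry_edge_unique ei ej _; rewrite le le'.
Qed.

(** The slots between two slots of one hemisphere belong to that hemisphere, because
the upper slots precede the lower ones. So interleaved components would lie in a
single hemisphere. *)
Lemma network_noncrossing : noncrossing (@slot_rank n) (@wend _ _ N) (@bend _ _ N)
  (interior_black N) edge_slot.
Proof.
move=> D e f e' f' a b c d eD e'D /edge_slotP[ia ea ->] /edge_slotP[ib fb ->].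
move=> /edge_slotP[ic ec ->] /edge_slotP[id fd ->] ef e'f' ne.
have hf := connect_hemisphere bdry_black ef; have hf' := connect_hemisphere bdry_black e'f'.
rewrite -hf -hf'.
have rk h (i : 'I_n) : slot_rank (mkslot h i) = ((if h then n else 0) + i)%N by case: h.
have hh : (slot_rank (mkslot (lower_edge e) ia) < slot_rank (mkslot (lower_edge e') ic)
    < slot_rank (mkslot (lower_edge e) ib))%N -> lower_edge e = lower_edge e'.
  have := ltn_ord ib; have := ltn_ord ic; rewrite !rk.
  by case: (lower_edge e); case: (lower_edge e') => /= ? ?; lia.
move=> rac; have ee' := hh rac; move: rac; rewrite !rk -ee' !ltn_add2l => /andP[iac icb].
have csym : connect_sym (adj (@wend _ _ N) (@bend _ _ N) (interior_black N) D).
  exact: connect_adj_sym.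
have fD := adj_in eD ef; have f'D := adj_in e'D e'f'.
have unique x y i : bend x = bdry N i -> bend y = bdry N i ->
  lower_edge x = lower_edge y -> x = y by apply: bdry_edge_unique.
apply/andP; split; rewrite ltnNge leq_eqVlt; apply/negP => /orP[/eqP/val_inj E|lt].
- rewrite E in fd; have f'e : f' = e by apply: unique fd ea _; rewrite -hf' ee'.
  by move: ne; rewrite csym -f'e e'f'.
- apply: (@no_crossing _ _ _ bdry_black D f' e e' f id ia ic ib) => //.
  + by rewrite csym.
  + by apply: contraNN ne => f'e; rewrite csym (connect_trans e'f').
  + by rewrite -hf' ee'.
- rewrite -E in fd; have f'f : f' = f by apply: unique fd fb _; rewrite -hf' -hf ee'.
  by move: ne; rewrite (connect_trans ef) // csym -f'f.
- by apply: (@no_crossing _ _ _ bdry_black D e e' f f' ia ic ib id).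
Qed.

Notation slotsN := (slots edge_slot).
Notation perfectN := (perfect (@wend _ _ N) (@bend _ _ N) (interior_white N) (interior_black N)).

Lemma incident_bdry e i : incident e (bdry N i) = (bend e == bdry N i).
Proof.
rewrite /incident orbC; case: eqVneq => // ei.
by case: (bdry_not_white bdry_black ei).
Qed.

Lemma mem_slots P h i : (mkslot h i \in slotsN P) =
  [exists e in P, incident e (bdry N i) && (lower_edge e == h)].
Proof.
rewrite inE; apply/exists_inP/exists_inP => -[e eP].
  move=> /eqP/edge_slotP[j ej hij]; exists e => //; rewrite incident_bdry ej.
  by case: h (lower_edge e) hij => [] [] //= [->]; rewrite !eqxx.
rewrite incident_bdry => /andP[/eqP ei /eqP <-]; exists e => //.
by apply/eqP/edge_slotP; exists i.
Qed.

Lemma used_upperE P : used_upper P = upper_part (slotsN P).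
Proof.
apply/setP => i; rewrite [LHS]inE [RHS]inE -[RHS]/(mkslot false i \in slotsN P).
rewrite mem_slots; apply: eq_existsb => e.
by rewrite upper_edgeE; case: (lower_edge e).
Qed.

Lemma used_lowerE P : used_lower P = lower_part (slotsN P).
Proof.
apply/setP => i; rewrite [LHS]inE [RHS]inE -[RHS]/(mkslot true i \in slotsN P).
by rewrite mem_slots; apply: eq_existsb => e; rewrite ?eqb_id.
Qed.

Lemma used_lifts (P : {set edge N}) : used P = used_upper P :|: used_lower P.
Proof.
apply/setP => i; rewrite !inE; apply/exists_inP/orP => [[e eP ei]|].
  case le: (lower_edge e); [right|left]; apply/exists_inP; exists e; rewrite // ei //=.
  by rewrite upper_edgeE le.
by case=> /exists_inP[e eP /andP[ei _]]; exists e.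
Qed.

(** An equatorial vertex has one edge in each hemisphere, so it is used at most once
exactly if its two slots are not both used. *)
Lemma almost_perfectE P : almost_perfect P =
  perfectN P && [disjoint upper_part (slotsN P) & lower_part (slotsN P)].
Proof.
rewrite /almost_perfect /perfect; congr (_ && _).
  have inc e v : v \notin codom (bdry N) ->
      incident e v = if black v then bend e == v else wend e == v.
    move=> vi; rewrite /incident; case: ifP => bv.
      case: (eqVneq (wend e) v) => [ev|]; last by rewrite orbF.
      by have := wend_white e; rewrite ev bv.
    case: (eqVneq (bend e) v) => [ev|] //.
    by have := bend_black e; rewrite ev bv.
  apply/forallP/andP => [H|[/forall_inP HW /forall_inP HB] v].
    split; apply/forall_inP => v; rewrite inE => /andP[bv vi];
    have := implyP (H v) vi; congr (_ == _); apply: eq_card => e; rewrite !inE inc //.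
      by rewrite (negPf bv).
    by rewrite bv.
  apply/implyP => vi; case bv: (black v).
    have := HB v; rewrite inE bv vi => /(_ isT).
    by congr (_ == _); apply: eq_card => e; rewrite !inE inc ?bv.
  have := HW v; rewrite inE bv vi => /(_ isT).
  by congr (_ == _); apply: eq_card => e; rewrite !inE inc ?bv.
rewrite -used_upperE -used_lowerE.
apply/forallP/pred0P => [H i|H i].
  apply/negbTE/negP => /andP[]; rewrite !inE => /exists_inP[e eP /andP[ei ue]].
  move=> /exists_inP[e' e'P /andP[e'i le']].
  have := card_le1_eqP (H i) e e'; rewrite !inE eP ei e'P e'i => /(_ isT isT) E.
  by move: ue; rewrite upper_edgeE -E le'.
apply/card_le1_eqP => e e'; rewrite !inE => /andP[eP ei] /andP[e'P e'i].
case: (eqVneq (lower_edge e) (lower_edge e')) => ee'.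
  move: ei e'i; rewrite !incident_bdry => /eqP ei /eqP e'i.
  exact: esym (bdry_edge_unique ei e'i ee').
have := H i; rewrite /= !inE => /negbT/negP[]; apply/andP.
have ue x : lower_edge x = false -> upper_edge x by rewrite upper_edgeE => ->.
case le: (lower_edge e) ee'; case le': (lower_edge e') => // _.
  split; apply/exists_inP; [exists e'|exists e] => //; first by rewrite e'i ue.
  by rewrite ei.
split; apply/exists_inP; [exists e|exists e'] => //; first by rewrite ei ue.
by rewrite e'i.
Qed.

Notation XN := (matching_sum (@wend _ _ N) (@bend _ _ N) (interior_white N)
    (interior_black N) edge_slot (@weight _ _ N)).

(** Group the matchings by the set of slots that they use, which determines the
sign. *)
Lemma equatorial_measurement_fold_slots I : equatorial_measurement N I = fold_slots XN I.
Proof.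
rewrite /fold_slots /matching_sum; under eq_bigr do rewrite mulr_sumr.
rewrite (exchange_big_dep perfectN) /=; last by move=> S P _ /andP[].
rewrite /equatorial_measurement.
rewrite [LHS](eq_bigl (fun P => perfectN P && lifts I (slotsN P))); last first.
  move=> P; rewrite almost_perfectE used_lifts used_upperE used_lowerE.
  by rewrite /lifts -andbA.
rewrite [LHS]big_mkcondr /=; apply: eq_bigr => P pP.
case: ifP => lP; last first.
  by rewrite big_pred0 // => S; rewrite pP /=; case: eqVneq => [<-|]; rewrite ?lP ?andbF.
rewrite (big_pred1 (slotsN P)) ?used_upperE ?used_lowerE // => S.
by rewrite pP /= eq_sym; case: eqVneq => [->|]; rewrite ?lP ?andbF.
Qed.

End NetworkSlots.

Theorem theorem19p9 (R : realType) (n : nat) (N : spherical_network R n)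
  (bdry_black : forall i : 'I_n, black (bdry N i))
  (k : nat)
  (hk : k%:Z = #|interior_white N|%:Z - #|interior_black N|%:Z)
  (hne : exists2 I : {set 'I_n}, #|I| = k & equatorial_measurement N I != 0) :
  Grassmannian_point k (equatorial_measurement N).
Proof.
have E := equatorial_measurement_fold_slots bdry_black.
rewrite (funext E) in hne *; apply: fold_slots_Grassmannian hne.
apply: matching_sum_plucker.
- exact: slot_rank_inj.
- exact: wend_interior.
- exact: edge_slot_None.
- exact: edge_slot_inj.
- exact: network_noncrossing.
Qed.
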